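(* Let $M_2$ be the focal submanifold of OT-FKM-type with $(m_1,m_2)=(1,k)$, where $k\geq 1$ is an integer; that is, $M_2=f^{-1}(-1)$, where $f=F|_{S^{2k+3}(1)}$, $$F:\mathbb{R}^{2k+4}\to\mathbb{R},\qquad F(x)=|x|^4-2\left(\langle P_0x,x\rangle^2+\langle P_1x,x\rangle^2\right),$$ and $\{P_0,P_1\}$ is a symmetric Clifford system on $\mathbb{R}^{2k+4}$. Then $$\lambda_1(M_2)=\min\{4,2+k\}.$$
   Context: A symmetric Clifford system $\{P_0,\dots,P_m\}$ on $\mathbb{R}^{2l}$ consists of symmetric $2l\times 2l$ real matrices satisfying $P_iP_j+P_jP_i=2\delta_{ij}I_{2l}$. The associated OT-FKM-type polynomial is $F(x)=|x|^4-2\sum_{i=0}^m\langle P_ix,x\rangle^2$ on $\mathbb{R}^{2l}$; the regular level hypersurfaces of $f=F|_{S^{2l-1}(1)}$ have four distinct constant principal curvatures with multiplicities $(m_1,m_2)=(m,l-m-1)$ (assuming $m>0$, $l-m-1>0$), and the focal submanifolds are $M_1=f^{-1}(1)$ and $M_2=f^{-1}(-1)$, of codimension $m_1+1$ and $m_2+1$ in $S^{2l-1}(1)$ respectively. The case $(m_1,m_2)=(1,k)$ is $m=1$, $l=k+2$. $M_2$ carries the metric induced from the unit sphere $S^{2k+3}(1)$ and has dimension $k+2$. For a compact connected Riemannian manifold $N$ without boundary, $\Delta f=-\mathrm{div}(\nabla f)$ is the Laplace-Beltrami operator on $C^\infty$ functions; its spectrum is $0=\lambda_0(N)<\lambda_1(N)\le\lambda_2(N)\le\cdots$,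 and $\lambda_1(N)$ is called the first eigenvalue of $N$. *)

(* Defs.v *)
From HB Require Import structures.
From mathcomp Require Import all_boot all_order all_algebra.
From mathcomp Require Import all_classical all_reals all_analysis.
Import Order.TTheory GRing.Theory Num.Theory numFieldNormedType.Exports.

Set Implicit Arguments.
Unset Strict Implicit.
Unset Printing Implicit Defensive.

Local Open Scope classical_set_scope.
Local Open Scope ring_scope.

(* [Ck k U f] is meant for open [U]: the values of ['D_v f] outside [U] are
   irrelevant. *)
Fixpoint Ck (R : realType) (V W : normedModType R) (k : nat)
    (U : set V) (f : V -> W) : Prop :=
  match k with
  | 0%N => forall x, U x -> {for x, continuous f}
  | k'.+1 => (forall x, U x -> differentiable f x) /\
             (forall v : V, Ck k' U (fun x => 'D_v f x))
  end.

Definition smooth (R : realType) (V W : normedModType R)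
    (U : set V) (f : V -> W) : Prop :=
  forall k, Ck k U f.

(* The Euclidean inner product; the library norm on ['rV[R]_n] is the sup norm
   and is only used here through the topology it induces. *)
Definition dot (R : realType) (n : nat) (u v : 'rV[R]_n) : R :=
  (u *m v^T) 0 0.

(** Riemannian geometry of an embedded submanifold [M] of R^n with the metric
    induced by [dot].  Functions and vector fields on [M] are represented by
    functions on R^n of which only the values on [M] matter.  The operators
    below are total; they have their usual meaning when [M] is an embedded
    submanifold and the function or field they act on is smooth on [M]. *)
Section Submanifold.
Context {R : realType} {n : nat}.
Local Notation V := 'rV[R]_n.
Implicit Types (M : set V) (f : V -> R) (X : V -> V) (p v w : V) (g : R -> V).

(* Smoothness on a subset of R^n: local extendability to a smooth function. *)
Definition smooth_on M f : Prop :=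
  forall p, M p -> exists (U : set V) (h : V -> R),
    [/\ open U, U p, smooth U h & forall x, U x -> M x -> h x = f x].

Definition curve_in M p g : Prop :=
  g 0 = p /\ exists e : R, [/\ 0 < e, smooth `]- e, e[%classic g &
                             forall t, `]- e, e[%classic t -> M (g t)].

Definition tangent M p : set V :=
  [set v | exists g, curve_in M p g /\ derive1 g 0 = v].

Definition orthonormal_basis (T : set V) (d : nat) (E : 'M[R]_(d, n)) : Prop :=
  E *m E^T = 1%:M /\ forall v, T v <-> (v <= E)%MS.

Definition tangent_proj M p w : V :=
  get [set u | tangent M p u /\ forall v, tangent M p v -> dot (w - u) v = 0].

(* The vector of T_pM representing df_p, where df_p(g'(0)) = (f o g)'(0). *)
Definition gradient M f p : V :=
  get [set w | tangent M p w /\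
    forall g, curve_in M p g -> derive1 (f \o g) 0 = dot w (derive1 g 0)].

Definition ambient_derivative M X p v : V :=
  get [set w | exists g,
    [/\ curve_in M p g, derive1 g 0 = v & derive1 (X \o g) 0 = w]].

(* The Levi-Civita connection of the induced metric (Gauss formula). *)
Definition covariant_derivative M X p v : V :=
  tangent_proj M p (ambient_derivative M X p v).

(* The trace of v |-> nabla_v X on T_pM, in any orthonormal basis. *)
Definition divergence M X p : R :=
  get [set r | exists (d : nat) (E : 'M[R]_(d, n)),
    orthonormal_basis (tangent M p) E /\
    r = \sum_(i < d) dot (covariant_derivative M X p (row i E)) (row i E)].

Definition laplacian M f p : R := - divergence M (gradient M f) p.

Definition eigenvalue_of M (mu : R) : Prop :=
  exists f, [/\ smooth_on M f,
                exists p, M p /\ f p != 0 &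
                forall p, M p -> laplacian M f p = mu * f p].

(* For compact connected [M] the eigenvalue 0 is simple, so that lambda_1 in
   0 = lambda_0 < lambda_1 <= lambda_2 <= ... is the least nonzero eigenvalue.
   The default value 0 is taken only when there is no such eigenvalue. *)
Definition first_eigenvalue M : R :=
  xget 0 [set lam | [/\ 0 < lam, eigenvalue_of M lam &
    forall mu, eigenvalue_of M mu -> mu != 0 -> lam <= mu]].

End Submanifold.

Section OT_FKM.
Context {R : realType} {m n : nat}.
Implicit Types (P : 'I_m.+1 -> 'M[R]_n) (x : 'rV[R]_n).

(* Matrices act on row vectors from the right, which is the same as the action
   on column vectors from the left since the [P i] are symmetric. *)
Definition symmetric_clifford_system P : Prop :=
  (forall i, (P i)^T = P i) /\
  (forall i j, P i *m P j + P j *m P i = (2 * (i == j)%:R)%:M).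

Definition OT_FKM_poly P x : R :=
  dot x x ^+ 2 - 2 * \sum_(i < m.+1) dot (x *m P i) x ^+ 2.

Definition unit_sphere : set 'rV[R]_n := [set x | dot x x = 1].

Definition focal_M2 P : set 'rV[R]_n :=
  unit_sphere `&` [set x | OT_FKM_poly P x = -1].

End OT_FKM.

(* Main.v *)
Require Import Defs.
From HB Require Import structures.
From mathcomp Require Import all_boot all_order all_algebra.
From mathcomp Require Import all_classical all_reals all_analysis.
From mathcomp Require Import ring lra.
Import Order.TTheory GRing.Theory Num.Theory numFieldNormedType.Exports.
Local Open Scope ring_scope.
Local Open Scope classical_set_scope.
Set Implicit Arguments.
Unset Strict Implicit.
Unset Printing Implicit Defensive.

(* With J = P0 P1, a complex structure, and V the (k+2)-dimensional +1
   eigenspace of P0, M2 is the set of all exp(t J) y with y in the unit sphere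
   S^(k+1) of V; so M2 is the quotient of S^1 x S^(k+1) by
   (t, y) ~ (t + pi, - y).  The functions <P0 x, x> = cos 2t and
   <x, y0> = cos t <y, y0> have eigenvalues 4 and k + 2.

   No integration is needed for the lower bound.  If u is an eigenfunction for
   mu that vanishes on the boundary of a compact domain carrying a positive v
   with Lap v < - mu v, then u / v has no nonzero extremum, so u = 0.  Let F be
   an eigenfunction, lifted to R x S^(k+1), with mu < min(4, k + 2).
   Antisymmetrize F in t (about any t0) and in y (about any hyperplane): the
   result vanishes on the boundary of a half circle times a hemisphere, whose
   first Dirichlet eigenvalue is 1 + (k + 1) > mu, hence it is 0.  Therefore
   F(t, y) - F(t, y') does not depend on t, and F becomes pi-periodic in t and
   even in y.  Antisymmetrizing in t alone, on a quarter circle (eigenvalue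
   4 > mu), shows that F does not depend on t; antisymmetrizing about two
   orthogonal hyperplanes of S^(k+1), on a quarter sphere, shows that F does not
   depend on y.  So F is constant, and mu = 0 or F = 0. *)

(** * Second-order jets of real functions *)

Lemma is_derive_unique {R : numFieldType} {V W : normedModType R} (f : V -> W)
  x v d d' : is_derive x v f d -> is_derive x v f d' -> d = d'.
Proof. by move=> [_ <-] [_ <-]. Qed.

Section Jets.
Context {R : realType}.
Implicit Types (f g : R -> R) (a b c : R).

(* [a], [b], [c] are the values at [0] of [f], [f'] and [f'']. *)
Definition jet f a b c := f 0 = a /\ exists f' : R -> R,
  [/\ (\forall t \near (0:R), is_derive (t : R) 1 f (f' t)), f' 0 = b &
      is_derive (0:R) 1 f' c].

Lemma jet_cst a : jet (fun=> a) a 0 0.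
Proof.
split=> //; exists (fun=> 0); split=> //; last exact: is_derive_cst.
by near=> t; exact: is_derive_cst.
Unshelve. all: by end_near. Qed.

Lemma jetD f g a b c a' b' c' : jet f a b c -> jet g a' b' c' ->
  jet (fun t => f t + g t) (a + a') (b + b') (c + c').
Proof.
move=> [<- [f' [nf <- df]]] [<- [g' [ng <- dg]]]; split=> //.
exists (fun t => f' t + g' t); split=> //; last exact: is_deriveD.
near=> t.
have h1 : is_derive (t : R) 1 f (f' t) by near: t.
have h2 : is_derive (t : R) 1 g (g' t) by near: t.
exact: is_deriveD.
Unshelve. all: by end_near. Qed.

Lemma jetM f g a b c a' b' c' : jet f a b c -> jet g a' b' c' ->
  jet (fun t => f t * g t) (a * a') (a * b' + b * a')
    (a * c' + 2 * b * b' + c * a').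
Proof.
move=> [<- [f' [nf <- df]]] [<- [g' [ng <- dg]]]; split=> //.
have nfg : \forall t \near (0:R), is_derive (t : R) 1 (fun t => f t * g t)
    (f t * g' t + f' t * g t).
  near=> t.
  have h1 : is_derive (t : R) 1 f (f' t) by near: t.
  have h2 : is_derive (t : R) 1 g (g' t) by near: t.
  apply: is_derive_eq; rewrite addrC /GRing.scale /=; ring.
exists (fun t => f t * g' t + f' t * g t); split=> //.
have h1 : is_derive (0:R) 1 f (f' 0) by exact: nbhs_singleton nf.
have h2 : is_derive (0:R) 1 g (g' 0) by exact: nbhs_singleton ng.
apply: is_derive_eq; rewrite /GRing.scale /=; ring.
Unshelve. all: by end_near. Qed.

Lemma jetZ f k a b c : jet f a b c ->
  jet (fun t => k * f t) (k * a) (k * b) (k * c).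
Proof.
by move=> /(jetM (jet_cst k)); rewrite !mul0r !(mulr0, mul0r, addr0).
Qed.

Lemma jetB f g a b c a' b' c' : jet f a b c -> jet g a' b' c' ->
  jet (fun t => f t - g t) (a - a') (b - b') (c - c').
Proof.
move=> jf /(jetZ (-1)) /(jetD jf); rewrite !mulN1r.
by congr (jet _ _ _ _); apply/funext => t; rewrite mulN1r.
Qed.

(** The flips [th |-> a - th] rest on this: the chain rule changes the sign of the second derivative
    twice. *)
Lemma jetN_arg f a b c : jet f a b c -> jet (fun t => f (- t)) a (- b) c.
Proof.
move=> [<- [f' [nf <- df]]]; split; first by rewrite oppr0.
have comp (h : R -> R) t d : is_derive (- t : R) 1 h d ->
    is_derive (t : R) 1 (fun t => h (- t)) (- d).
  move=> hd; apply: DeriveDef.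
    apply/derivable1_diffP; apply: (@differentiable_comp _ _ _ _ -%R h).
      exact/derivable1_diffP.
    by apply/derivable1_diffP; case: hd.
  have := @derive1_comp _ -%R h t (@derivable_opp _ _ _) (@ex_derive _ _ _ _ _ _ _ hd).
  by rewrite !derive1E /comp => ->; rewrite derive_val derive_val mulrN1.
exists (fun t => - f' (- t)); split; rewrite ?oppr0 //.
  have : \forall t \near (0:R), is_derive (- t : R) 1 f (f' (- t)).
    have : (- t : R) @[t --> (0:R)] --> (0 : R).
      by rewrite -[X in _ --> X]oppr0; exact: cvgN.
    by move=> /(_ _ nf).
  by move=> nf'; near=> t; apply: comp; near: t.
have := comp f' 0 c; rewrite oppr0 => /(_ df) hd.
by apply: is_derive_eq; rewrite opprK.
Unshelve. all: by end_near. Qed.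

Lemma near_jet f g a b c : (\forall t \near (0:R), f t = g t) ->
  jet f a b c -> jet g a b c.
Proof.
move=> fg [<- [f' [nf <- df]]]; split; first by rewrite (nbhs_singleton fg).
exists f'; split=> //.
have nfg := near_join fg.
near=> t; apply: near_eq_is_derive; last by near: t; exact: nf.
by near: t.
Unshelve. all: by end_near. Qed.

Lemma jet_unique f a b c a' b' c' : jet f a b c -> jet f a' b' c' ->
  [/\ a = a', b = b' & c = c'].
Proof.
move=> [<- [f' [nf <- df]]] [<- [g' [ng <- dg]]].
have fg : \forall t \near (0:R), f' t = g' t.
  near=> t.
  have h1 : is_derive (t : R) 1 f (f' t) by near: t.
  have h2 : is_derive (t : R) 1 f (g' t) by near: t.
  exact: is_derive_unique h1 h2.
split=> //; first exact: nbhs_singleton fg.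
have h := near_eq_is_derive fg df.
exact: is_derive_unique h dg.
Unshelve. all: by end_near. Qed.

(** A maximum at [0] forces [f' 0 = 0]. If [c] were positive, [f'] would be positive just to the
    right of [0], and the mean value theorem would give a larger value of [f] there. *)
Lemma jet_max f a b c : jet f a b c -> (\forall t \near (0:R), f t <= a) -> c <= 0.
Proof.
move=> [<- [f' [nf _ df]]] mf; rewrite leNgt; apply/negP => c0.
have [e /= e0 he] : exists2 e, 0 < e & forall t, `|t| < e ->
    is_derive (t : R) 1 f (f' t) /\ f t <= f 0.
  have [e /= e0 he] : \forall t \near (0:R), is_derive (t : R) 1 f (f' t) /\ f t <= f 0.
    by near=> t; split; near: t.
  by exists e => // t te; apply: he; rewrite /= sub0r normrN.
have f'0 : f' 0 = 0.
  have hm : is_derive (0:R) 1 f 0.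
    apply: (@derive1_at_max _ _ (- e) e); rewrite ?in_itv/=.
    - by move: e0; lra.
    - move=> t; rewrite in_itv/= -ltr_norml => /he[h _].
      by case: h.
    - by rewrite oppr_lt0 e0.
    - by move=> t; rewrite in_itv/= -ltr_norml => /he[].
  have h : is_derive (0:R) 1 f (f' 0) by apply: (he 0 _).1; rewrite normr0.
  exact: is_derive_unique h hm.
(* As [f' 0 = 0], the difference quotients of [f'] at [0] are [f' t / t], and they tend to
   [c > 0]. *)
have pf : \forall t \near 0^'+, 0 < f' t.
  have dq : t^-1 *: (f' (t *: 1 + 0) - f' 0) @[t --> 0^'] --> c.
    by rewrite -(@derive_val _ _ _ _ _ _ _ df); exact: (@ex_derive _ _ _ _ _ _ _ df).
  have dq' : t^-1 *: (f' (t *: 1 + 0) - f' 0) @[t --> 0^'+] --> c.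
    apply: cvg_trans dq; apply: cvg_app.
    by move=> A [r r0 Ar]; exists r => // x xr x0; apply: Ar => //; exact: lt0r_neq0.
  near=> t.
  have t0 : 0 < t by near: t; exact: nbhs_right_gt.
  have : 0 < t^-1 *: (f' (t *: 1 + 0) - f' 0).
    by near: t; apply: (cvgr_gt _ dq').
  by rewrite f'0 subr0 addr0 [_%:A]mulr1 /GRing.scale /= pmulr_rgt0 ?invr_gt0.
have [r /= r0 hr] : exists2 r, 0 < r & forall t, 0 < t -> t < r -> 0 < f' t.
  case: pf => r /= r0 hr; exists r => // t t0 tr; apply: hr => //=.
  by rewrite sub0r normrN gtr0_norm.
(* Below [r] the derivative is positive; below [e] it exists and [f] is bounded by [f 0]. *)
pose s := Num.min r e / 2.
have s0 : 0 < s by rewrite /s divr_gt0 ?lt_min ?r0.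
have sr : s < Num.min r e by rewrite /s ltr_pdivrMr // ltr_pMr ?ltr1n // lt_min r0.
have [/= sr1 se1] : s < r /\ s < e by move: sr; rewrite lt_min => /andP[].
have [x xs] : exists2 x, x \in `]0, s[%R & f s - f 0 = f' x * (s - 0).
  apply: MVT => //.
    move=> x; rewrite in_itv/= => /andP[x0 xs].
    by apply: (he x _).1; rewrite gtr0_norm // (lt_trans xs).
  apply: derivable_within_continuous => x; rewrite in_itv/= => /andP[x0 xs].
  have [h _] : is_derive x 1 f (f' x) /\ f x <= f 0.
    by apply: he; rewrite ger0_norm // (le_lt_trans xs).
  by case: h.
move: xs; rewrite in_itv/= subr0 => /andP[x0 xs] E.
have [_] := he s ltac:(by rewrite gtr0_norm).
by rewrite -subr_le0 E leNgt mulr_gt0 // hr // (lt_trans xs).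
Unshelve. all: by end_near. Qed.

End Jets.

(** * Inner products, reflections and frames *)

Section Dot.
Context {R : realType} {n : nat}.
Implicit Types (u v w x y : 'rV[R]_n) (a : R).

Lemma dotE u v : dot u v = \sum_i u 0 i * v 0 i.
Proof. by rewrite /dot mxE; apply: eq_bigr => i _; rewrite mxE. Qed.

Lemma dotC u v : dot u v = dot v u.
Proof. by rewrite !dotE; apply: eq_bigr => i _; rewrite mulrC. Qed.

Lemma dotDl u v w : dot (u + v) w = dot u w + dot v w.
Proof. by rewrite /dot mulmxDl mxE. Qed.

Lemma dotZl a u v : dot (a *: u) v = a * dot u v.
Proof. by rewrite /dot -scalemxAl mxE. Qed.

Lemma dotNl u v : dot (- u) v = - dot u v.
Proof. by rewrite /dot mulNmx mxE. Qed.

Lemma dotDr u v w : dot w (u + v) = dot w u + dot w v.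
Proof. by rewrite dotC dotDl !(dotC w). Qed.

Lemma dotZr a u v : dot u (a *: v) = a * dot u v.
Proof. by rewrite dotC dotZl dotC. Qed.

Lemma dotNr u v : dot u (- v) = - dot u v.
Proof. by rewrite dotC dotNl dotC. Qed.

Lemma dot0l u : dot 0 u = 0.
Proof. by rewrite /dot mul0mx mxE. Qed.

Lemma dot0r u : dot u 0 = 0.
Proof. by rewrite dotC dot0l. Qed.

Definition dot_lin := (dotDl, dotDr, dotZl, dotZr, dotNl, dotNr, dot0l, dot0r).

Lemma dot_mulmx p u (v : 'rV[R]_p) (A : 'M[R]_(n, p)) :
  dot (u *m A) v = dot u (v *m A^T).
Proof. by rewrite /dot trmx_mul trmxK mulmxA. Qed.

Lemma dot_row p (A : 'M[R]_(p, n)) i v : dot (row i A) v = (A *m v^T) i 0.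
Proof. by rewrite /dot -row_mul mxE. Qed.

Lemma dot_row2 p q (A : 'M[R]_(p, n)) (B : 'M[R]_(q, n)) i j :
  dot (row i A) (row j B) = (A *m B^T) i j.
Proof. by rewrite /dot !mxE; apply: eq_bigr => k _; rewrite !mxE. Qed.

Lemma dot_ge0 u : 0 <= dot u u.
Proof. by rewrite dotE sumr_ge0 // => i _; rewrite -expr2 sqr_ge0. Qed.

Lemma dot_eq0 u : (dot u u == 0) = (u == 0).
Proof.
apply/eqP/eqP => [|->]; last by rewrite dot0l.
rewrite dotE => /psumr_eq0P h; apply/rowP => i; rewrite mxE; apply/eqP.
by rewrite -sqrf_eq0 expr2 h // => j _; rewrite -expr2 sqr_ge0.
Qed.

Lemma dot_mulmx_tr u v w : u *m (v^T *m w) = dot u v *: w.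
Proof. by rewrite mulmxA [u *m _]mx11_scalar mul_scalar_mx. Qed.

Lemma dot_unit_le1 x y : dot x x = 1 -> dot y y = 1 -> dot x y <= 1.
Proof.
move=> hx hy; have := dot_ge0 (x - y).
by rewrite !dot_lin hx hy (dotC y x); lra.
Qed.

Lemma dot_normalize u : u != 0 ->
  dot ((Num.sqrt (dot u u))^-1 *: u) ((Num.sqrt (dot u u))^-1 *: u) = 1.
Proof.
move=> u0; rewrite !dot_lin mulrA -expr2 exprVn sqr_sqrtr ?dot_ge0 //.
by rewrite mulVf // dot_eq0.
Qed.

(** For a unit vector [e], the reflection in the hyperplane orthogonal to [e]. *)
Definition reflection (e : 'rV[R]_n) : 'M[R]_n := 1%:M - 2 *: (e^T *m e).

Lemma mulmx_reflection y e : y *m reflection e = y - (2 * dot y e) *: e.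
Proof.
by rewrite /reflection mulmxBr mulmx1 -scalemxAr dot_mulmx_tr scalerA.
Qed.

Lemma tr_reflection e : (reflection e)^T = reflection e.
Proof. by rewrite /reflection linearB /= trmx1 linearZ /= trmx_mul trmxK. Qed.

Lemma reflectionK e : dot e e = 1 -> reflection e *m reflection e = 1%:M.
Proof.
move=> he; apply/row_matrixP => i; rewrite row_mul mulmx_reflection.
have -> : row i (reflection e) = row i 1%:M *m reflection e.
  by rewrite -row_mul mul1mx.
rewrite mulmx_reflection !dot_lin he mulr1 -addrA -opprD -scalerDl.
set c := dot _ _; have -> : 2 * c + 2 * (c - 2 * c) = 0 :> R by ring.
by rewrite scale0r subr0.
Qed.

Lemma dot_reflection e x y : dot e e = 1 ->
  dot (x *m reflection e) (y *m reflection e) = dot x y.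
Proof.
by move=> he; rewrite dot_mulmx tr_reflection -mulmxA reflectionK // mulmx1.
Qed.

(** The normal is the normalized [x - y]. Since [x] and [y] have the same length, [dot x (x - y)] is
    half of [dot (x - y) (x - y)], so the reflection subtracts exactly [x - y] from [x]. *)
Lemma reflection_swap x y : dot x x = 1 -> dot y y = 1 -> x != y ->
  exists2 e, dot e e = 1 & x *m reflection e = y.
Proof.
move=> hx hy xy; exists ((Num.sqrt (dot (x - y) (x - y)))^-1 *: (x - y)).
  by rewrite dot_normalize // subr_eq0.
have D : dot (x - y) (x - y) = 2 * (1 - dot x y).
  by rewrite !dot_lin hx hy (dotC y x); ring.
have D0 : dot (x - y) (x - y) != 0 by rewrite dot_eq0 subr_eq0.
rewrite mulmx_reflection dotZr scalerA.
have -> : 2 * ((Num.sqrt (dot (x - y) (x - y)))^-1 * dot x (x - y)) *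
  (Num.sqrt (dot (x - y) (x - y)))^-1 = 1.
  set r := Num.sqrt _.
  have r2 : r ^+ 2 = dot (x - y) (x - y) by rewrite sqr_sqrtr ?dot_ge0.
  have r0 : r != 0 by rewrite -sqrf_eq0 r2.
  have -> : dot x (x - y) = r ^+ 2 / 2 by rewrite r2 D !dot_lin hx; field.
  by field.
by rewrite scale1r opprB addrC subrK.
Qed.

End Dot.

Section Frames.
Context {R : realType} {d : nat}.
Implicit Types (y e : 'rV[R]_d.+1) (E : 'M[R]_(d, d.+1)).

(** The rows of [E] are an orthonormal basis of the tangent space of the unit sphere at [y]; the
    last clause is the completeness relation, which yields Parseval's identity in [frame_sum]. *)
Definition frame y E :=
  [/\ dot y y = 1, E *m E^T = 1%:M, E *m y^T = 0 & E^T *m E = 1%:M - y^T *m y].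

Lemma frame_row y E i : frame y E ->
  dot (row i E) (row i E) = 1 /\ dot y (row i E) = 0.
Proof.
move=> [_ h1 h2 _]; split.
  by rewrite dot_row2 h1 mxE eqxx.
by rewrite dotC dot_row h2 mxE.
Qed.

Lemma frame_sum y E e e' : frame y E ->
  \sum_i dot (row i E) e * dot (row i E) e' = dot e e' - dot y e * dot y e'.
Proof.
move=> [_ _ _ h].
have -> : \sum_i dot (row i E) e * dot (row i E) e' =
  (e *m (E^T *m E) *m e'^T) 0 0.
  rewrite mulmxA -mulmxA mxE; apply: eq_bigr => i _.
  by rewrite !dot_row -[E *m e^T]trmxK trmx_mul trmxK mxE.
by rewrite h mulmxBr mulmx1 dot_mulmx_tr -[LHS]/(dot _ _) !dot_lin (dotC e y).
Qed.

Lemma frame_reflection y E e : dot e e = 1 -> frame y E ->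
  frame (y *m reflection e) (E *m reflection e).
Proof.
move=> he [h1 h2 h3 h4]; split.
- by rewrite dot_reflection.
- by rewrite trmx_mul tr_reflection mulmxA -(mulmxA E) reflectionK // mulmx1.
- by rewrite trmx_mul tr_reflection mulmxA -(mulmxA E) reflectionK // mulmx1.
- rewrite !trmx_mul tr_reflection !mulmxA -(mulmxA _ E^T) h4 -(mulmxA _ y^T).
  move: (reflection e) (reflectionK he) => H HH.
  by rewrite mulmxBr mulmx1 mulmxBl HH !mulmxA.
Qed.

(** A reflection carrying the first basis vector to [y] is an orthogonal matrix with first row [y];
    its other rows form [E]. *)
Lemma frame_exists y : dot y y = 1 -> exists E, frame y E.
Proof.
move=> hy.
have [H [HH HH' Hy]] : exists H : 'M[R]_(1 + d),
    [/\ H *m H^T = 1%:M, H^T *m H = 1%:M & usubmx H = y].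
  have h0 : dot (delta_mx 0 0 : 'rV[R]_d.+1) (delta_mx 0 0) = 1.
    rewrite dotE big_ord_recl big1 ?addr0 => [|i _]; rewrite !mxE ?mulr1 //=.
    by rewrite mul0r.
  have usub (H : 'M[R]_(1 + d)) : usubmx H = delta_mx 0 0 *m H.
    apply/rowP => j; rewrite -rowE !mxE.
    by congr (fun_of_matrix H _ j); apply/val_inj.
  have [Ey|ney] := eqVneq y (delta_mx 0 0).
    by exists 1%:M; rewrite Ey usub trmx1 !mulmx1.
  have [|e he hr] := reflection_swap h0 hy; first by rewrite eq_sym.
  exists (reflection e); split; rewrite ?tr_reflection ?reflectionK //.
  by rewrite usub.
exists (dsubmx H); split=> //.
all: move: HH HH'; rewrite -[H]vsubmxK Hy tr_col_mx mul_col_row mul_row_col.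
all: rewrite (@scalar_mx_block _ 1 d 1) => /eq_block_mx[_ h1 h2 h3].
all: rewrite ?col_mxKd // => h4.
by rewrite -h4 [X in X - _]addrC addrK.
Qed.

End Frames.

(** * Calculus on row vectors *)

Section Calculus.
Context {R : realType}.

Lemma is_derive_cos_affine (c a x : R) :
  is_derive (x : R) 1 (fun t => cos (c * t + a)) (- c * sin (c * x + a)).
Proof.
have h : is_derive (x : R) 1 (fun t => c * t + a) c.
  by apply: is_derive_eq; rewrite addr0 [_ *: _]mulr1.
apply: DeriveDef.
  by apply/derivable1_diffP; apply: (@differentiable_comp _ _ _ _
    (fun t => c * t + a) cos); apply/derivable1_diffP; case: h.
rewrite -derive1E (@derive1_comp _ (fun t => c * t + a) cos) //.
by rewrite !derive1E !derive_val mulrC mulrN mulNr.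
Qed.

Lemma jet_cos_affine (c a : R) :
  jet (fun t => cos (c * t + a)) (cos a) (- c * sin a) (- c ^+ 2 * cos a).
Proof.
split; first by rewrite mulr0 add0r.
exists (fun t => - c * sin (c * t + a)); split.
- by near=> t; exact: is_derive_cos_affine.
- by rewrite mulr0 add0r.
(* With the sine written as a shifted cosine, the same derivative rule applies a second time. *)
- have E : (fun t => - c * sin (c * t + a)) =
           (fun t => - c * cos (c * t + (a - pi / 2))).
    by apply/funext => t; rewrite addrA cosBpihalf.
  rewrite E; have h := is_derive_cos_affine c (a - pi / 2) 0.
  apply: is_derive_eq.
  by rewrite mulr0 add0r sinBpihalf /GRing.scale /=; ring.
Unshelve. all: by end_near. Qed.

Lemma jet_cos : jet (@cos R) 1 0 (- 1).
Proof.
have := jet_cos_affine 1 0; rewrite cos0 sin0 mulr0 mulr1 expr1n.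
by congr jet; apply/funext => t; rewrite mul1r addr0.
Qed.

Lemma jet_sin : jet (@sin R) 0 1 0.
Proof.
have := jet_cos_affine 1 (- (pi / 2)).
rewrite cosN cos_pihalf sinN sin_pihalf mulrNN mulr1 mulr0.
by congr jet; apply/funext => t; rewrite mul1r cosBpihalf.
Qed.

Lemma differentiable_mulmx m n (A : 'M[R]_(m, n)) (x : 'rV[R]_m) :
  differentiable (fun x : 'rV[R]_m => x *m A) x.
Proof.
have -> : (fun x : 'rV[R]_m => x *m A) =
    \sum_(i < m) (fun x : 'rV[R]_m => x 0 i *: row i A).
  by apply/funext => z; rewrite mulmx_sum_row fct_sumE.
apply: differentiable_sum => i; apply: differentiableZl.
exact: differentiable_coord.
Qed.

Lemma differentiable_dot (V : normedModType R) n (f g : V -> 'rV[R]_n) x :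
  differentiable f x -> differentiable g x ->
  differentiable (fun x => dot (f x) (g x)) x.
Proof.
move=> df dg.
have -> : (fun x => dot (f x) (g x)) =
    \sum_(i < n) (fun x => f x 0 i * g x 0 i).
  by apply/funext => z; rewrite dotE fct_sumE.
apply: differentiable_sum => i; apply: differentiableM.
  by apply: (@differentiable_comp _ _ _ _ f (fun M : 'rV[R]_n => M 0 i)) => //;
    exact: differentiable_coord.
by apply: (@differentiable_comp _ _ _ _ g (fun M : 'rV[R]_n => M 0 i)) => //;
  exact: differentiable_coord.
Qed.

Lemma mulmxr_continuous m n (A : 'M[R]_(m, n)) :
  continuous (fun x : 'rV[R]_m => x *m A).
Proof. by move=> x; apply: differentiable_continuous; exact: differentiable_mulmx. Qed.

Lemma dotl_continuous n (e : 'rV[R]_n) : continuous (fun x => dot x e).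
Proof.
move=> x; apply: differentiable_continuous; apply: differentiable_dot => //.
Qed.

Lemma dot_continuous n : continuous (fun x : 'rV[R]_n => dot x x).
Proof.
move=> x; apply: differentiable_continuous; apply: differentiable_dot => //.
Qed.

Lemma within_continuous_comp (S T U : topologicalType) (A : set S) (B : set T)
    (f : S -> T) (g : T -> U) : continuous f -> (forall x, A x -> B (f x)) ->
  {within B, continuous g} -> {within A, continuous (fun x => g (f x))}.
Proof.
move=> cf AB /subspace_continuousP cg; apply/subspace_continuousP => x Ax.
apply: (@cvg_comp _ _ _ f g _ (within B (nbhs (f x)))); last exact: cg (AB _ Ax).
move=> P; rewrite /within /= => hP.
have : \forall z \near x, B (f z) -> P (f z) by exact: cf hP.
by apply: filterS => z h Az; apply: h; exact: AB.
Qed.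

Lemma within_continuousB (T : topologicalType) (A : set T) (f g : T -> R) :
  {within A, continuous f} -> {within A, continuous g} ->
  {within A, continuous (fun x => f x - g x)}.
Proof. by move=> cf cg x; apply: cvgB; [exact: cf|exact: cg]. Qed.

Lemma compact_sphere n : compact [set y : 'rV[R]_n | dot y y = 1].
Proof.
apply: bounded_closed_compact.
  exists 1; split; first exact: num_real.
  move=> M M1 y /= y1; apply: le_trans (ltW M1).
  rewrite /Num.Def.normr /= mx_normrE; apply: bigmax_le => //= -[i j] _ /=.
  rewrite -(@ler_pXn2r _ 2) ?nnegrE // expr1n -normrX ger0_norm ?sqr_ge0 //.
  rewrite ord1 -y1 dotE (bigD1 j) //= -expr2 lerDl sumr_ge0 // => k _.
  by rewrite -expr2 sqr_ge0.
apply: (@closed_comp _ _ (fun y : 'rV[R]_n => dot y y) [set 1]).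
  by move=> x _; exact: dot_continuous.
exact: closed_eq.
Qed.

End Calculus.

(** * Great circles *)

Section Arcs.
Context {R : realType} {n : nat}.
Implicit Types (y v e : 'rV[R]_n) (A : 'M[R]_n).

Definition arc y v (t : R) := cos t *: y + sin t *: v.

Lemma arc0 y v : arc y v 0 = y.
Proof. by rewrite /arc cos0 sin0 scale1r scale0r addr0. Qed.

Lemma arc_mulmx p y v t (A : 'M[R]_(n, p)) :
  arc y v t *m A = cos t *: (y *m A) + sin t *: (v *m A).
Proof. by rewrite mulmxDl -!scalemxAl. Qed.

Lemma dot_arc y v t : dot y y = 1 -> dot v v = 1 -> dot y v = 0 ->
  dot (arc y v t) (arc y v t) = 1.
Proof.
move=> hy hv hyv; rewrite !dot_lin hy hv (dotC v) hyv -[RHS](cos2Dsin2 t); ring.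
Qed.

Lemma jet_dot_arc y v e :
  jet (fun t => dot (arc y v t) e) (dot y e) (dot v e) (- dot y e).
Proof.
have := jetD (jetM jet_cos (jet_cst (dot y e))) (jetM jet_sin (jet_cst (dot v e))).
have -> : (fun t => cos t * dot y e + sin t * dot v e) =
  (fun t => dot (arc y v t) e).
  by apply/funext => t; rewrite !dot_lin.
by congr jet; ring.
Qed.

Lemma arc_continuous y v : continuous (arc y v).
Proof.
move=> t; apply: cvgD; apply: cvgZl.
  exact: continuous_cos.
exact: continuous_sin.
Qed.

End Arcs.

Section ContinuousFunctions.
Context {R : realType} {T : topologicalType}.
Implicit Types f g : T -> R.

Lemma continuous_fun_pair (U V : topologicalType) (f : T -> U) (g : T -> V) :
  continuous f -> continuous g -> continuous (fun z => (f z, g z)).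
Proof. by move=> cf cg z; exact: cvg_pair (cf z) (cg z). Qed.

Lemma continuous_funD f g :
  continuous f -> continuous g -> continuous (fun z => f z + g z).
Proof. by move=> cf cg z; exact: cvgD (cf z) (cg z). Qed.

Lemma continuous_funB f g :
  continuous f -> continuous g -> continuous (fun z => f z - g z).
Proof. by move=> cf cg z; exact: cvgB (cf z) (cg z). Qed.

Lemma continuous_funM f g :
  continuous f -> continuous g -> continuous (fun z => f z * g z).
Proof. by move=> cf cg z; exact: cvgM (cf z) (cg z). Qed.

Lemma continuous_fun_comp (U V : topologicalType) (f : T -> U) (g : U -> V) :
  continuous f -> continuous g -> continuous (fun z => g (f z)).
Proof. by move=> cf cg z; exact: continuous_comp (cf z) (cg (f z)). Qed.

Lemma continuous_fun_cst (U : topologicalType) (a : U) :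
  continuous (fun _ : T => a).
Proof. by move=> z; exact: cvg_cst. Qed.

Lemma continuous_fst (U : topologicalType) : continuous (@fst T U).
Proof. by move=> z; exact: cvg_fst. Qed.

Lemma continuous_snd (U : topologicalType) : continuous (@snd U T).
Proof. by move=> z; exact: cvg_snd. Qed.

End ContinuousFunctions.

(** * Maximum principle on R x S^d *)

Section Laplacian.
Context {R : realType} {d : nat}.
Implicit Types (y e : 'rV[R]_d.+1) (E : 'M[R]_(d, d.+1)).
Implicit Types (F G u v : R -> 'rV[R]_d.+1 -> R) (th r mu : R).

(* The Laplacian of [F] on R x S^d at [(th, y)] is [r], as the sum of the second
   derivatives of [F] along the geodesics whose initial velocities are the
   [th]-axis and the rows of [E]. *)
Definition lap F th y E r := exists (c0 : R) (c : 'I_d -> R),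
  [/\ exists b, jet (fun t => F (th + t) y) (F th y) b c0,
      forall i, exists b,
        jet (fun t => F th (arc y (row i E) t)) (F th y) b (c i) &
      r = c0 + \sum_i c i].

Lemma lap_unique F th y E r r' : lap F th y E r -> lap F th y E r' -> r = r'.
Proof.
move=> [c0 [c [[b hb] hc ->]]] [c0' [c' [[b' hb'] hc' ->]]].
have [_ _ ->] := jet_unique hb hb'; congr (_ + _); apply: eq_bigr => i _.
by have [[? h] [? h']] := (hc i, hc' i); have [] := jet_unique h h'.
Qed.

Lemma lapB F G th y E r r' : lap F th y E r -> lap G th y E r' ->
  lap (fun th y => F th y - G th y) th y E (r - r').
Proof.
move=> [c0 [c [[b hb] hc ->]]] [c0' [c' [[b' hb'] hc' ->]]].
exists (c0 - c0'), (fun i => c i - c' i); split.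
- by exists (b - b'); exact: jetB.
- by move=> i; have [[x h] [x' h']] := (hc i, hc' i); exists (x - x'); exact: jetB.
- by rewrite sumrB; ring.
Qed.

Lemma lap0 th y E : lap (fun _ _ => 0) th y E 0.
Proof.
exists 0, (fun=> 0); split; last by rewrite big1 ?addr0.
  by exists 0; exact: jet_cst.
by move=> i; exists 0; exact: jet_cst.
Qed.

Lemma lap_flip F a th y E r : lap F (a - th) y E r ->
  lap (fun th y => F (a - th) y) th y E r.
Proof.
move=> [c0 [c [[b hb] hc ->]]]; exists c0, c; split=> //; exists (- b).
have := jetN_arg hb; congr jet; apply/funext => t; congr (F _ _); ring.
Qed.

(** A linear map carries arcs to arcs, so the frame is transported together with the point. *)
Lemma lap_mulmx F (A : 'M[R]_d.+1) th y E r : lap F th (y *m A) (E *m A) r ->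
  lap (fun th y => F th (y *m A)) th y E r.
Proof.
move=> [c0 [c [hb hc ->]]]; exists c0, c; split=> // i.
have [b h] := hc i; exists b; move: h; congr jet; apply/funext => t.
by rewrite arc_mulmx -row_mul.
Qed.

(* At a maximum of [u / v] with value [W > 0], [u - W v] is maximal along each
   geodesic, so [- mu u <= W r < - mu W v = - mu u].  The second alternative for
   the [th]-direction allows domains contained in one slice. *)
Lemma max_principle (D : set (R * 'rV[R]_d.+1)) u v mu : compact D ->
  {within D, continuous (fun z => u z.1 z.2)} ->
  {within D, continuous (fun z => v z.1 z.2)} ->
  (forall th y, D (th, y) -> 0 < v th y) ->
  (forall th y, D (th, y) -> u th y <= 0 \/ exists E r,
    [/\ lap u th y E (- mu * u th y), lap v th y E r, r < - mu * v th y,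
        (\forall t \near (0 : R), D (th + t, y)) \/
        (forall t, u (th + t) y = u th y /\ v (th + t) y = v th y) &
        forall i, \forall t \near (0 : R), D (th, arc y (row i E) t)]) ->
  forall th y, D (th, y) -> u th y <= 0.
Proof.
move=> cD cu cv v0 H th0 y0 D0.
have [] : exists2 c, c \in D & forall z, z \in D ->
    u z.1 z.2 / v z.1 z.2 <= u c.1 c.2 / v c.1 c.2.
  apply: (@compact_EVT_max _ _ (fun z => u z.1 z.2 / v z.1 z.2)) => //.
    by exists (th0, y0).
  rewrite continuous_subspace_in => z zD; apply: cvgM; first exact: cu.
  by apply: cvgV; [rewrite gt_eqF // v0 //; case: z zD => ? ?; rewrite inE|exact: cv].
move=> [th y]; rewrite inE /= => Dc cmax.
set W := u th y / v th y in cmax.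
have uW a z : D (a, z) -> u a z <= W * v a z.
  move=> Daz; rewrite -ler_pdivrMr ?v0 //.
  by apply: (cmax (a, z)); rewrite inE.
have uW0 : u th y = W * v th y by rewrite divfK // gt_eqF // v0.
have W0 : W <= 0.
  rewrite leNgt; apply/negP => W0.
  have [u0|[E [r [lu lv rv Hth Hy]]]] := H _ _ Dc.
    by move: u0; rewrite uW0 leNgt mulr_gt0 // v0.
  move: lu lv => [c0 [c [[b hb] hc Ec]]] [c0' [c' [[b' hb'] hc' Ec']]].
  have c00 : c0 - W * c0' <= 0.
    apply: (jet_max (jetB hb (jetZ W hb'))); rewrite -uW0 subrr.
    case: Hth => [Hth|Hth].
      by near=> t; rewrite subr_le0 uW //; near: t.
    by near=> t; have [-> ->] := Hth t; rewrite uW0 subrr.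
  have ci i : c i - W * c' i <= 0.
    have [[x hx] [x' hx']] := (hc i, hc' i).
    apply: (jet_max (jetB hx (jetZ W hx'))); rewrite -uW0 subrr.
    have Hi := Hy i.
    by near=> t; rewrite subr_le0 uW //; near: t.
  have : \sum_i (c i - W * c' i) <= 0 by apply: sumr_le0.
  rewrite sumrB -mulr_sumr => cs.
  have : W * r < W * (- mu * v th y) by rewrite ltr_pM2l.
  have : W * (- mu * v th y) = - mu * u th y by rewrite uW0; ring.
  rewrite Ec Ec' => ->; lra.
by rewrite (le_trans (uW _ _ D0)) // mulr_le0_ge0 // ltW // v0.
Unshelve. all: by end_near. Qed.

Lemma max_principle0 (D : set (R * 'rV[R]_d.+1)) u v mu : compact D ->
  {within D, continuous (fun z => u z.1 z.2)} ->
  {within D, continuous (fun z => v z.1 z.2)} ->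
  (forall th y, D (th, y) -> 0 < v th y) ->
  (forall th y, D (th, y) -> u th y = 0 \/ exists E r,
    [/\ lap u th y E (- mu * u th y), lap v th y E r, r < - mu * v th y,
        (\forall t \near (0 : R), D (th + t, y)) \/
        (forall t, u (th + t) y = u th y /\ v (th + t) y = v th y) &
        forall i, \forall t \near (0 : R), D (th, arc y (row i E) t)]) ->
  forall th y, D (th, y) -> u th y = 0.
Proof.
move=> cD cu cv v0 H th y Dz; apply/eqP; rewrite eq_le; apply/andP; split.
  apply: (@max_principle D u v mu cD cu cv v0 _ th y Dz) => a z Daz.
  by have [->|h] := H a z Daz; [left|right].
(* The hypotheses on [u] are invariant under a change of sign, so the bound applies to [- u] as
   well. *)
rewrite -oppr_le0 -sub0r.
apply: (@max_principle D (fun a z => 0 - u a z) v mu cD _ cv v0 _ th y Dz).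
  by apply: within_continuousB => //; apply: continuous_subspaceT => z; exact: cvg_cst.
move=> a z Daz; have [->|[E [r [lu lv rv Hth Hy]]]] := H a z Daz.
  by left; rewrite subr0.
right; exists E, r; split=> //.
  have := lapB (lap0 a z E) lu; congr lap; ring.
case: Hth => [?|Hth]; [by left|right] => t.
by have [-> ->] := Hth t.
Qed.

End Laplacian.

(** * Positive barriers on the closed hemisphere *)

Section Barrier.
Context {R : realType} (d : nat) (d_ge2 : 2 <= d%:R :> R).
Implicit Types (y e : 'rV[R]_d.+1) (E : 'M[R]_(d, d.+1)).

(* A perturbation of the first Dirichlet eigenfunction [s = <y, e>] of the
   hemisphere, positive up to the boundary: its eigenvalue drops only from [d]
   to any prescribed [lam < d]. *)
Definition bar (eps s : R) := s + eps * (1 - d%:R * (s * s)).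

(** With this value the terms in [s] and [s ^+ 2] that carry no factor [lam * eps] combine in
    [bar_lap] to [(d - lam) * (s ^+ 2 - s)], which is nonpositive on [[0, 1]]. *)
Definition bar_eps lam : R := (d%:R - lam) / (2 * d%:R * (d%:R + 1)).

Lemma bar_epsP lam : 0 <= lam < d%:R ->
  [/\ 0 < bar_eps lam, bar_eps lam * (2 * d%:R * (d%:R + 1)) = d%:R - lam &
      bar_eps lam * (2 * d%:R) <= 1].
Proof.
move=> /andP[l0 ld].
have D0 : 0 < 2 * d%:R * (d%:R + 1) :> R by move: d_ge2; nra.
have e0 : 0 < bar_eps lam by rewrite divr_gt0 // subr_gt0.
have eE : bar_eps lam * (2 * d%:R * (d%:R + 1)) = d%:R - lam.
  by rewrite divfK // gt_eqF.
split=> //; move: eE d_ge2; move: (bar_eps lam) e0 => eps e0 eE d2.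
nra.
Qed.

(** As [2 * d * eps <= 1] and [s * s <= s], the negative term is at most [s / 2], and [eps]
    remains. *)
Lemma bar_gt0 lam s : 0 <= lam < d%:R -> 0 <= s <= 1 -> 0 < bar (bar_eps lam) s.
Proof.
move=> /bar_epsP[e0 _ e1] /andP[s0 s1]; rewrite /bar; move: (bar_eps _) e0 e1.
move: d_ge2 => d2 eps e0 e1; have : s * s <= s by nra.
nra.
Qed.

Lemma jet_bar eps (f : R -> R) a b c : jet f a b c ->
  jet (fun t => bar eps (f t)) (bar eps a) (b * (1 - 2 * eps * d%:R * a))
    (c * (1 - 2 * eps * d%:R * a) - 2 * eps * d%:R * b ^+ 2).
Proof.
move=> h; have := jetD h (jetZ eps (jetB (jet_cst 1) (jetZ d%:R (jetM h h)))).
by congr jet; rewrite /bar; ring.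
Qed.

(** The left side is the spherical second-derivative sum of the barrier, as given by [jet_bar] and
    [jet_dot_arc]; [frame_sum] turns the sum of squares into [1 - s ^+ 2]. Strictness comes from the
    constant term [eps * (2 * d - lam)]. *)
Lemma bar_lap lam y e E : 0 <= lam < d%:R -> frame y E -> dot e e = 1 ->
  0 <= dot y e ->
  \sum_i (- dot y e * (1 - 2 * bar_eps lam * d%:R * dot y e)
    - 2 * bar_eps lam * d%:R * dot (row i E) e ^+ 2)
  < - lam * bar (bar_eps lam) (dot y e).
Proof.
move=> hl fr he s0; have [hy _ _ _] := fr.
have s1 := dot_unit_le1 hy he.
rewrite sumrB sumr_const card_ord -mulr_sumr.
under eq_bigr do rewrite expr2.
rewrite (frame_sum _ _ fr) he /bar -mulr_natr.
have [e0 eE _] := bar_epsP hl; case/andP: hl => l0 ld.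
move: (bar_eps lam) (dot y e) e0 eE s0 s1 d_ge2 => eps s e0 eE s0 s1 d2.
have ss : s * s <= s by nra.
have h1 : eps * (2 * d%:R * (d%:R + 1)) * (s * s) <= (d%:R - lam) * s.
  by rewrite eE; nra.
have h2 : 0 < eps * (2 * d%:R - lam) by nra.
have h3 : 0 <= eps * d%:R * lam * (s * s) by rewrite !mulr_ge0 // ?ltW //; lra.
nra.
Qed.

Lemma bar_continuous eps e : continuous (fun y => bar eps (dot y e)).
Proof.
have c := @dotl_continuous R _ e.
apply: continuous_funD => //; apply: continuous_funM; first exact: continuous_fun_cst.
apply: continuous_funB; first exact: continuous_fun_cst.
apply: continuous_funM; first exact: continuous_fun_cst.
exact: continuous_funM.
Qed.

End Barrier.

(** * Eigenfunctions on R x S^d with antipodal symmetry *)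

Section Rigidity.
Context {R : realType} {d : nat} (d_ge2 : 2 <= d%:R :> R) (mu : R).
Implicit Types (y e : 'rV[R]_d.+1) (E : 'M[R]_(d, d.+1)).
Implicit Types (F G : R -> 'rV[R]_d.+1 -> R) (th a c lam : R).

Definition cylinder : set (R * 'rV[R]_d.+1) := [set z | dot z.2 z.2 = 1].

(** The sign is that of [lap], a sum of second derivatives, opposite to [laplacian]. *)
Definition eigen G := {within cylinder, continuous (fun z => G z.1 z.2)} /\
  forall th y E, frame y E -> lap G th y E (- mu * G th y).

Definition alt_flip a G th y := G th y - G (a - th) y.
Definition alt_refl e G th y := G th y - G th (y *m reflection e).

Lemma eigen_alt_flip a G : eigen G -> eigen (alt_flip a G).
Proof.
move=> [cG lG]; split.
  apply: within_continuousB => //.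
  apply: (within_continuous_comp (f := fun z : R * 'rV[R]_d.+1 => (a - z.1, z.2)) _ _ cG).
    apply: continuous_fun_pair; last exact: continuous_snd.
    by apply: continuous_funB; [exact: continuous_fun_cst|exact: continuous_fst].
  by [].
move=> th y E fr; have := lapB (lG th y E fr) (lap_flip (lG (a - th) y E fr)).
by congr lap; rewrite /alt_flip; ring.
Qed.

Lemma eigen_alt_refl e G : dot e e = 1 -> eigen G -> eigen (alt_refl e G).
Proof.
move=> he [cG lG]; split.
  apply: within_continuousB => //.
  apply: (within_continuous_comp
    (f := fun z : R * 'rV[R]_d.+1 => (z.1, z.2 *m reflection e)) _ _ cG).
    apply: continuous_fun_pair; first exact: continuous_fst.
    apply: (continuous_fun_comp (g := fun y => y *m reflection e)).
      exact: continuous_snd.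
    exact: mulmxr_continuous.
  by move=> z /=; rewrite /cylinder /= dot_reflection.
move=> th y E fr.
have := lapB (lG th y E fr) (lap_mulmx (lG th _ _ (frame_reflection he fr))).
by congr lap; rewrite /alt_refl; ring.
Qed.

(** Separation of variables; [gi] lists the second derivatives of [g] along the frame. *)
Lemma lap_cos_mul c a (g : 'rV[R]_d.+1 -> R) th y E (gi : 'I_d -> R) :
  (forall i, exists b, jet (fun t => g (arc y (row i E) t)) (g y) b (gi i)) ->
  lap (fun th y => cos (c * th + a) * g y) th y E
    (cos (c * th + a) * (\sum_i gi i - c ^+ 2 * g y)).
Proof.
move=> hg; exists (- c ^+ 2 * cos (c * th + a) * g y),
  (fun i => cos (c * th + a) * gi i); split.
- exists (- c * sin (c * th + a) * g y).
  have := jetM (jet_cos_affine c (c * th + a)) (jet_cst (g y)).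
  rewrite mulr0 add0r.
  have -> : (fun t => cos (c * t + (c * th + a)) * g y) =
    (fun t => cos (c * (th + t) + a) * g y).
    by apply/funext => t; congr (cos _ * _); ring.
  by congr jet; ring.
- move=> i; have [b h] := hg i; exists (cos (c * th + a) * b).
  exact: jetZ h.
- by rewrite -mulr_sumr; ring.
Qed.

Lemma near_arc_gt0 y v e : 0 < dot y e ->
  \forall t \near (0 : R), 0 < dot (arc y v t) e.
Proof.
move=> h; have : (fun t : R => dot (arc y v t) e) @ (0 : R) --> dot y e.
  rewrite -[in X in _ --> X](arc0 y v).
  exact: (continuous_fun_comp (@arc_continuous _ _ y v) (@dotl_continuous _ _ e)).
by move=> /cvgr_gt; apply.
Qed.

Lemma near_shift_itv th a b : a < th < b ->
  \forall t \near (0 : R), a <= th + t <= b.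
Proof.
move=> /andP[h1 h2].
have c : (fun t : R => th + t) @ (0 : R) --> th.
  rewrite -[X in _ --> X]addr0.
  by apply: (continuous_funD (@continuous_fun_cst _ _ th)) => z; exact: cvg_id.
near=> t; apply/andP; split; apply: ltW; near: t.
  by move/cvgr_gt : c; apply.
by move/cvgr_lt : c; apply.
Unshelve. all: by end_near. Qed.

(** Symmetry about every centre makes every [2 * t] with [t] at most [r] in absolute value a period
    of [h], and any [x] is a sum of finitely many equal such periods. *)
Lemma const_of_symmetries (h : R -> R) (r : R) : 0 < r ->
  (forall a t, 0 <= t <= r -> h (a + t) = h (a - t)) -> forall x, h x = h 0.
Proof.
move=> r0 H x.
have H' a t : `|t| <= r -> h (a + t) = h (a - t).
  have [t0 tr|t0 tr] := ger0P t; first by apply: H; rewrite t0.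
  have := H a (- t); rewrite opprK => ->//.
  by rewrite oppr_ge0 ltW.
set n := (Num.bound (`|x| / r)).
have nx : `|x| / r < n.+1%:R.
  rewrite (lt_trans (archi_boundP _)) ?ltr_nat //.
  by rewrite divr_ge0 // ltW.
pose t := x / n.+1%:R / 2.
have tr : `|t| <= r.
  rewrite /t !normrM !normfV !normr_nat ler_pdivrMr // ler_pdivrMr ?ltr0n //.
  move: nx; rewrite ltr_pdivrMr // => /ltW h0; rewrite (le_trans h0) // mulrC.
  by rewrite -mulrA ler_pM2l // ler_peMl ?ler0n ?ler1n.
have step m : h (m%:R * (2 * t)) = h 0.
  elim: m => [|m <-]; first by rewrite mul0r.
  rewrite (_ : m.+1%:R * (2 * t) = (m%:R * (2 * t) + t) + t); last first.
    by rewrite -natr1; ring.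
  by rewrite H' // addrK.
by rewrite -(step n.+1); congr h; rewrite /t; field; rewrite nat1r pnatr_eq0.
Qed.

Lemma compact_cylinder_part a b (A : set 'rV[R]_d.+1) : closed A ->
  compact (`[a, b]%classic `*` ([set y | dot y y = 1] `&` A)).
Proof.
move=> cA; apply: compact_setX; first exact: segment_compact.
exact: compact_closedI (@compact_sphere _ _) cA.
Qed.

Lemma closed_halfspace e : closed [set y | 0 <= dot y e].
Proof.
apply: (@closed_comp _ _ (fun y => dot y e) [set x | 0 <= x]).
  by move=> x _; exact: dotl_continuous.
exact: closed_ge.
Qed.

(** This allows the normal to be chosen with [0 <= dot y e]. *)
Lemma reflectionN e : reflection (- e) = reflection e.
Proof. by rewrite /reflection [(- e)^T]linearN /= mulNmx mulmxN opprK. Qed.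

Lemma reflection_fix y e : dot y e = 0 -> y *m reflection e = y.
Proof. by move=> h; rewrite mulmx_reflection h mulr0 scale0r subr0. Qed.

Lemma subset_cylinder (I : set R) (A : set 'rV[R]_d.+1) :
  I `*` ([set y | dot y y = 1] `&` A) `<=` cylinder.
Proof. by move=> z [_ []]. Qed.

Lemma cos_affine_gt0 c m r th : 0 <= c -> c * r < pi / 2 -> m - r <= th <= m + r ->
  0 < cos (c * th + (- (c * m))) :> R.
Proof. by move=> c0 cr /andP[h1 h2]; apply: cos_gt0_pihalf; nra. Qed.

Lemma continuous_cos_mul c a (g : 'rV[R]_d.+1 -> R) : continuous g ->
  continuous (fun z : R * 'rV[R]_d.+1 => cos (c * z.1 + a) * g z.2).
Proof.
move=> cg; apply: continuous_funM.
  apply: continuous_fun_comp (@continuous_cos R).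
  apply: continuous_funD; last exact: continuous_fun_cst.
  by apply: continuous_funM; [exact: continuous_fun_cst|exact: continuous_fst].
by apply: continuous_fun_comp cg; exact: continuous_snd.
Qed.

Section Reflect.
Hypothesis mu_lt : mu < d%:R + 1.

(** The frequency [c] and the rate [lam] stay strictly below the Dirichlet values [1] of the half
    circle and [d] of the hemisphere, so that both barriers are positive up to the boundary. *)
Lemma split_rates : exists c lam : R,
  [/\ 0 <= c < 1, 0 <= lam < d%:R & mu <= c ^+ 2 + lam].
Proof.
(* Here [(1 - eta) ^+ 2 + (d - eta)] exceeds [d + 1 - 3 * eta >= mu], and [eta <= 1/2] keeps both
   rates nonnegative. *)
pose eta := Num.min (1/2) ((d%:R + 1 - mu) / 3) : R.
have e0 : 0 < eta by rewrite lt_min divr_gt0 //= divr_gt0 // subr_gt0.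
have e1 : eta <= 1/2 by rewrite ge_min lexx.
have e2 : eta <= (d%:R + 1 - mu) / 3 by rewrite ge_min lexx orbT.
exists (1 - eta), (d%:R - eta); split; move: d_ge2 e0 e1 e2 => *; nra.
Qed.

(** The flip fixes the end [a / 2] of the half circle and moves the other end by a full period, and
    the reflection fixes the equator; so the function vanishes on the boundary and the maximum
    principle applies. *)
Lemma alt_flip_refl0 a e G : dot e e = 1 -> eigen G ->
  (forall th y, dot y y = 1 -> G (th + pi + pi) y = G th y) ->
  forall th y, a / 2 <= th <= a / 2 + pi -> dot y y = 1 -> 0 <= dot y e ->
  alt_flip a (alt_refl e G) th y = 0.
Proof.
move=> he eG per th0 y0 hth0 hy0 hs0.
have [c [lam [/andP[c0 c1] hl hmu]]] := split_rates.
have [cu lu] := eigen_alt_flip a (eigen_alt_refl he eG).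
(* The midpoint of the half circle, where the cosine factor of the barrier is centred. *)
pose m := a / 2 + pi / 2.
pose v th y := cos (c * th + (- (c * m))) * bar d (bar_eps d lam) (dot y e).
pose D : set (R * 'rV[R]_d.+1) :=
  `[a / 2, a / 2 + pi]%classic `*` ([set y | dot y y = 1] `&` [set y | 0 <= dot y e]).
have pi0 := pi_gt0 R.
have cosD th : a / 2 <= th <= a / 2 + pi -> 0 < cos (c * th + (- (c * m))).
  move=> /andP[h1 h2].
  by apply: (@cos_affine_gt0 _ _ (pi / 2)) => //; rewrite /m; nra.
apply: (@max_principle0 _ _ D _ v mu) => //.
- exact: compact_cylinder_part (@closed_halfspace e).
- exact: continuous_subspaceW (@subset_cylinder _ _) cu.
- apply: continuous_subspaceT.
  apply: (continuous_cos_mul (g := fun y => bar d (bar_eps d lam) (dot y e))).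
  exact: bar_continuous.
- move=> th y [/= h [hy s0]]; rewrite mulr_gt0 //.
    by apply: cosD; move: h; rewrite in_itv.
  by rewrite bar_gt0 // s0 dot_unit_le1.
move=> th y [/= ]; rewrite in_itv /= => hth [hy s0].
have [Eth|th1] := eqVneq th (a / 2).
  by left; rewrite /alt_flip Eth (_ : a - a / 2 = a / 2) ?subrr //; field.
have [Eth|th2] := eqVneq th (a / 2 + pi).
  left; rewrite /alt_flip (_ : th = a - th + pi + pi); last by rewrite Eth; field.
  rewrite /alt_refl !per ?dot_reflection // (_ : a - (a - th + pi + pi) = a - th).
    by rewrite subrr.
  by rewrite Eth; field.
have [s00|s1] := eqVneq (dot y e) 0.
  by left; rewrite /alt_flip /alt_refl reflection_fix // !subrr.
have sgt : 0 < dot y e by rewrite lt_def s1.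
right; have [E fr] := frame_exists hy; exists E.
eexists; split; first exact: lu fr.
- apply: lap_cos_mul => i; eexists; apply: jet_bar.
  exact: jet_dot_arc.
(* The barrier has [lap] equal to the cosine times [S - c ^+ 2 * B], where [S < - lam * B] and
   [mu <= c ^+ 2 + lam]. *)
- have h1 := bar_lap d_ge2 hl fr he s0.
  have h2 := cosD _ hth.
  have h3 : 0 < bar d (bar_eps d lam) (dot y e) by rewrite bar_gt0 // s0 dot_unit_le1.
  rewrite /v (mulrCA (- mu)) ltr_pM2l //; move: h1 h3; set S := \sum_i _.
  move: (bar _ _ _) => B; nra.
- left; have h : a / 2 < th < a / 2 + pi.
    by rewrite !lt_neqAle eq_sym th1 th2.
  have := near_shift_itv h; apply: filterS => t ht; split=> //=.
- move=> i; have := near_arc_gt0 (row i E) sgt; apply: filterS => t ht.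
  split=> /=; first by rewrite in_itv.
  by have [? ?] := frame_row i fr; split; rewrite ?dot_arc // ltW.
Qed.

(** With [e] the normal of the reflection exchanging [y] and [y'], the difference is [alt_refl e G],
    which is symmetric in time about every centre. *)
Lemma alt_refl_const G th y y' : eigen G ->
  (forall th y, dot y y = 1 -> G (th + pi + pi) y = G th y) ->
  dot y y = 1 -> dot y' y' = 1 -> G th y - G th y' = G 0 y - G 0 y'.
Proof.
move=> eG per hy hy'.
have [<-|yy'] := eqVneq y y'; first by rewrite !subrr.
have [e he <-] := reflection_swap hy hy' yy'.
apply: (const_of_symmetries (h := fun th => alt_refl e G th y) (pi_gt0 R)).
(* The flip with parameter [2 * a] has centre [a]. *)
move=> a t ht; have h1 : (2 * a) / 2 <= a + t <= (2 * a) / 2 + pi.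
  rewrite mulrC mulKf //; move/andP: ht => [? ?]; lra.
have : alt_flip (2 * a) (alt_refl e G) (a + t) y = 0.
  have [s0|s0] := leP 0 (dot y e); first exact: alt_flip_refl0.
  have := @alt_flip_refl0 (2 * a) (- e) G.
  rewrite /alt_refl reflectionN; apply=> //; first by rewrite !dot_lin opprK.
  by rewrite !dot_lin oppr_ge0 ltW.
rewrite /alt_flip (_ : 2 * a - (a + t) = a - t); last by ring.
by move=> /eqP; rewrite subr_eq0 => /eqP.
Qed.

End Reflect.

(** Period [pi] makes the antisymmetrized function vanish at both ends of a quarter circle, while a
    cosine of frequency [c < 2] centred there stays positive. *)
Lemma flip_invariant G th y : mu < 4 -> eigen G ->
  (forall th y, dot y y = 1 -> G (th + pi) y = G th y) -> dot y y = 1 ->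
  G th y = G 0 y.
Proof.
move=> mu4 eG per hy0; have pi0 := pi_gt0 R.
have [c [c0 c2 cmu]] : exists c : R, [/\ 0 <= c, c < 2 & mu < c ^+ 2].
  (* Division by [5] instead of [4] makes [(2 - eta) ^+ 2 > 4 - 4 * eta] strictly larger than
     [mu]. *)
  pose eta := Num.min 1 ((4 - mu) / 5) : R.
  have e0 : 0 < eta by rewrite lt_min ltr01 divr_gt0 // subr_gt0.
  have e1 : eta <= 1 by rewrite ge_min lexx.
  have e2 : eta <= (4 - mu) / 5 by rewrite ge_min lexx orbT.
  by exists (2 - eta); split; move: e0 e1 e2 => *; nra.
apply: (const_of_symmetries (h := fun th => G th y) (r := pi / 2)).
  by rewrite divr_gt0.
move=> a t ht.
have [cu lu] := eigen_alt_flip (2 * a) eG.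
pose m := a + pi / 4.
pose v (th : R) (y : 'rV[R]_d.+1) := cos (c * th + (- (c * m))) * 1.
pose D : set (R * 'rV[R]_d.+1) :=
  `[a, a + pi / 2]%classic `*` ([set y | dot y y = 1] `&` setT).
suff h : alt_flip (2 * a) G (a + t) y = 0.
  apply/eqP; rewrite -subr_eq0 -h /alt_flip; apply/eqP.
  by congr (_ - G _ _); ring.
have : D (a + t, y).
  by split=> //=; rewrite in_itv /=; move/andP: ht => [? ?]; lra.
apply: (@max_principle0 _ _ D _ v mu) => //.
- exact: compact_cylinder_part closedT.
- exact: continuous_subspaceW (@subset_cylinder _ _) cu.
- apply: continuous_subspaceT.
  apply: (continuous_cos_mul (g := fun y => 1)); exact: continuous_fun_cst.
- move=> s z [/= + _]; rewrite in_itv /= /v mulr1 => /andP[h1 h2].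
  by apply: (@cos_affine_gt0 _ _ (pi / 4)) => //; rewrite /m; nra.
move=> s z [/= ]; rewrite in_itv /= => hs [hz _].
have [Es|s1] := eqVneq s a.
  by left; rewrite /alt_flip Es (_ : 2 * a - a = a) ?subrr //; ring.
have [Es|s2] := eqVneq s (a + pi / 2).
  left; rewrite /alt_flip (_ : s = 2 * a - s + pi); last by rewrite Es; field.
  rewrite per // (_ : 2 * a - (2 * a - s + pi) = 2 * a - s) ?subrr //.
  by rewrite Es; field.
right; have [E fr] := frame_exists hz; exists E.
eexists; split; first exact: lu fr.
- apply: (@lap_cos_mul _ _ (fun=> 1) s z E (fun=> 0)) => i; exists 0.
  exact: jet_cst.
- have h : 0 < cos (c * s + - (c * m)).
    move/andP: hs => [? ?].
    by apply: (@cos_affine_gt0 _ _ (pi / 4)) => //; rewrite /m; nra.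
  by rewrite /v big1 // mulrCA ltr_pM2l // !mulr1 sub0r ltrN2.
- left; have h : a < s < a + pi / 2 by rewrite !lt_neqAle eq_sym s1 s2.
  by have := near_shift_itv h; apply: filterS => r hr; split.
- move=> i; near=> r; split=> //=; split=> //.
  by have [? ?] := frame_row i fr; rewrite dot_arc.
Unshelve. all: by end_near. Qed.

(* The quarter sphere has first Dirichlet eigenvalue [2 (d + 1)], but [mu < d + 1]
   leaves enough room for a product of barriers of rate [(d + 1) / 2] each. *)
Lemma alt_refl2_0 e1 e2 G y : mu < d%:R + 1 -> eigen G ->
  (forall th y, dot y y = 1 -> G th y = G 0 y) ->
  dot e1 e1 = 1 -> dot e2 e2 = 1 -> dot e1 e2 = 0 -> dot y y = 1 ->
  0 <= dot y e1 -> 0 <= dot y e2 -> alt_refl e2 (alt_refl e1 G) 0 y = 0.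
Proof.
move=> mud eG Gc he1 he2 he12 hy0 hy1 hy2.
have [cu lu] := eigen_alt_refl he2 (eigen_alt_refl he1 eG).
pose lam : R := (d%:R + 1) / 2.
have hl : 0 <= lam < d%:R by rewrite /lam; move: d_ge2 => *; lra.
pose b := bar d (bar_eps d lam).
pose g y := b (dot y e1) * b (dot y e2).
pose v (th : R) y := cos (0 * th + 0) * g y.
(* The domain lies in the slice [th = 0]; since nothing depends on [th], the second alternative of
   the maximum principle applies. *)
pose D : set (R * 'rV[R]_d.+1) := `[0, 0]%classic `*` ([set y | dot y y = 1] `&`
  ([set y | 0 <= dot y e1] `&` [set y | 0 <= dot y e2])).
have bgt0 e z : dot e e = 1 -> dot z z = 1 -> 0 <= dot z e -> 0 < b (dot z e).
  by move=> he hz h; rewrite bar_gt0 // h dot_unit_le1.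
have : D (0, y) by split=> //=; rewrite in_itv /= lexx.
apply: (@max_principle0 _ _ D _ v mu) => //.
- by apply: compact_cylinder_part; apply: closedI; exact: closed_halfspace.
- exact: continuous_subspaceW (@subset_cylinder _ _) cu.
- apply: continuous_subspaceT; apply: (continuous_cos_mul (g := g)).
  by apply: continuous_funM; exact: bar_continuous.
- move=> th z [_ [hz [h1 h2]]]; rewrite /v mul0r addr0 cos0 mul1r mulr_gt0 //.
    exact: bgt0.
  exact: bgt0.
move=> th z [hth [/= hz [h1 h2]]].
have refl12 (w : 'rV[R]_d.+1) : w *m reflection e1 *m reflection e2 =
    w *m reflection e2 *m reflection e1.
  rewrite !mulmx_reflection !dot_lin (dotC e2 e1) he12.
  by apply/rowP => j; rewrite !mxE; ring.
have [s0|s1] := eqVneq (dot z e1) 0.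
  left; rewrite /alt_refl -refl12 (reflection_fix s0) //; ring.
have [s0|s2] := eqVneq (dot z e2) 0.
  left; rewrite /alt_refl (reflection_fix s0) //; ring.
have gt1 : 0 < dot z e1 by rewrite lt_def s1.
have gt2 : 0 < dot z e2 by rewrite lt_def s2.
right; have [E fr] := frame_exists hz; exists E.
eexists; split; first exact: lu fr.
- apply: (@lap_cos_mul _ _ g th z E) => i; eexists.
  by apply: jetM; apply: jet_bar; exact: jet_dot_arc.
- rewrite /v mul0r addr0 cos0 !mul1r expr0n /= mul0r subr0.
  have k1 := bar_lap d_ge2 hl fr he1 h1.
  have k2 := bar_lap d_ge2 hl fr he2 h2.
  have [p1 p2] := (bgt0 _ _ he1 hz h1, bgt0 _ _ he2 hz h2).
  have fs := frame_sum e1 e2 fr.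
  have [q1 q2] := (dot_unit_le1 hz he1, dot_unit_le1 hz he2).
  have [E0 _ E1] := bar_epsP d_ge2 hl.
  under eq_bigr do rewrite -/b.
  rewrite !big_split /= -mulr_sumr -mulr_suml -/b.
  set S := \sum_(i < d) _ * _ * _.
  (* The cross term of the product rule. By orthogonality of [e1] and [e2], [frame_sum] makes it
     nonpositive on the quarter sphere. *)
  have -> : S = 2 * (1 - 2 * bar_eps d lam * d%:R * dot z e1) *
      (1 - 2 * bar_eps d lam * d%:R * dot z e2) * (0 - dot z e1 * dot z e2).
    rewrite -he12 -fs mulr_sumr; apply: eq_bigr => i _; ring.
  rewrite /g; move: k1 k2 p1 p2; rewrite -/b; set S1 := \sum_i _; set S2 := \sum_i _.
  move: (b (dot z e1)) (b (dot z e2)) => B1 B2 k1 k2 p1 p2.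
  have m1 : B1 * S2 < B1 * (- lam * B2) by rewrite ltr_pM2l.
  have m2 : S1 * B2 < (- lam * B1) * B2 by rewrite ltr_pM2r.
  have m3 : 0 <= 2 * (1 - 2 * bar_eps d lam * d%:R * dot z e1) *
      (1 - 2 * bar_eps d lam * d%:R * dot z e2) * (dot z e1 * dot z e2).
    have w s : 0 <= s <= 1 -> 0 <= 1 - 2 * bar_eps d lam * d%:R * s.
      by move=> /andP[]; move: (bar_eps d lam) E0 E1 d_ge2 => *; nra.
    by rewrite !mulr_ge0 // w ?h1 ?h2.
  have m4 : mu * (B1 * B2) < (d%:R + 1) * (B1 * B2) by rewrite ltr_pM2r // mulr_gt0.
  have m5 : B1 * (- lam * B2) + - lam * B1 * B2 = - ((d%:R + 1) * (B1 * B2)).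
    by rewrite /lam; field.
  rewrite sub0r mulrN; lra.
- right=> t; rewrite /v !mul0r; split=> //.
  rewrite /alt_refl !(Gc (th + t)) ?dot_reflection // !(Gc th) ?dot_reflection //.
- move=> i; have n1 := near_arc_gt0 (row i E) gt1.
  have n2 := near_arc_gt0 (row i E) gt2.
  have [? ?] := frame_row i fr.
  near=> t; split=> //=; split; first by rewrite dot_arc.
  by split; apply: ltW; near: t.
Unshelve. all: by end_near. Qed.

(* [h := alt_refl e G 0] is invariant under reflections orthogonal to [e], one of
   which maps [y] to minus its mirror image; as [h] is even and odd under [e], it
   vanishes. *)
Lemma eigen_even_const G y y' : mu < d%:R + 1 -> eigen G ->
  (forall th y, dot y y = 1 -> G th y = G 0 y) ->
  (forall y, dot y y = 1 -> G 0 (- y) = G 0 y) ->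
  dot y y = 1 -> dot y' y' = 1 -> G 0 y = G 0 y'.
Proof.
move=> mud eG Gc Gev hy hy'.
have [<-//|yy'] := eqVneq y y'.
have [e he <-] := reflection_swap hy hy' yy'.
set s := dot y e; pose w := y - s *: e.
have we : dot w e = 0 by rewrite /w !dot_lin he mulr1 subrr.
suff h : alt_refl e G 0 y = alt_refl e G 0 (- (y *m reflection e)).
  move: h; rewrite /alt_refl mulNmx -mulmxA reflectionK // mulmx1.
  by rewrite !Gev ?dot_reflection //; lra.
have Ey : y = w + s *: e by rewrite /w subrK.
have -> : - (y *m reflection e) = s *: e - w.
  rewrite mulmx_reflection -/s Ey; apply/rowP => j; rewrite !mxE; ring.
(* If [y] is a multiple of [e], then [s *: e - w] is [y] itself. *)
have [w0|w0] := eqVneq w 0.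
  by rewrite [in LHS]Ey w0 add0r subr0.
pose e2 := (Num.sqrt (dot w w))^-1 *: w.
have he2 : dot e2 e2 = 1 by rewrite dot_normalize.
have he12 : dot e e2 = 0 by rewrite /e2 dotZr dotC we mulr0.
have he21 : dot e2 e = 0 by rewrite dotC.
have -> : s *: e - w = y *m reflection e2.
  rewrite mulmx_reflection {1 2}Ey dotDl dotZl he12 mulr0 addr0.
  have r0 : 0 < dot w w by rewrite lt_def dot_eq0 w0 dot_ge0.
  rewrite /e2 dotZr scalerA.
  have -> : 2 * ((Num.sqrt (dot w w))^-1 * dot w w) * (Num.sqrt (dot w w))^-1 = 2.
    set q := Num.sqrt _; have q0 : q != 0 by rewrite gt_eqF // sqrtr_gt0.
    have -> : dot w w = q ^+ 2 by rewrite sqr_sqrtr // ltW.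
    by field.
  by apply/rowP => j; rewrite !mxE; ring.
suff : alt_refl e2 (alt_refl e G) 0 y = 0.
  by rewrite {1}/alt_refl => /eqP; rewrite subr_eq0 => /eqP.
have refN e' : dot e' e' = 1 -> dot (- e') (- e') = 1 by rewrite !dot_lin opprK.
have altN e' H : alt_refl (- e') H = alt_refl e' H.
  by apply/funext => a; apply/funext => z; rewrite /alt_refl reflectionN.
have posN e' : dot y e' < 0 -> 0 <= dot y (- e').
  by rewrite dotNr oppr_ge0; exact: ltW.
have [eN Ne NN] : [/\ dot e (- e2) = 0, dot (- e) e2 = 0 & dot (- e) (- e2) = 0].
  by split; rewrite ?dotNl ?dotNr he12 ?oppr0.
(* Replacing [e] or [e2] by its opposite brings [y] into the closed quarter sphere. *)
have [s1|s1] := leP 0 (dot y e); have [s2|s2] := leP 0 (dot y e2).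
- exact: alt_refl2_0.
- by rewrite -altN; apply: alt_refl2_0 => //; [exact: refN|exact: posN].
- by rewrite -(altN e); apply: alt_refl2_0 => //; [exact: refN|exact: posN].
- rewrite -altN -(altN e).
  by apply: alt_refl2_0 => //; [exact: refN|exact: refN|exact: posN|exact: posN].
Qed.

Lemma eigen_antipodal0 F th y : mu < 4 -> mu < d%:R + 1 -> mu != 0 -> eigen F ->
  (forall th y, dot y y = 1 -> F (th + pi) (- y) = F th y) -> dot y y = 1 ->
  F th y = 0.
Proof.
move=> mu4 mud mu0 eF pF hy.
have hN z : dot z z = 1 :> R -> dot (- z) (- z) = 1 by rewrite !dot_lin opprK.
have per2 a z : dot z z = 1 -> F (a + pi + pi) z = F a z.
  by move=> hz; rewrite -(opprK z) pF ?hN // opprK -[in RHS]pF ?opprK // hN.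
have FN a z : dot z z = 1 -> F a (- z) = F (a + pi) z.
  by move=> hz; rewrite -[in RHS](opprK z) pF ?hN.
have per a z : dot z z = 1 -> F (a + pi) z = F a z.
  (* The difference over a shift by [pi] is independent of [b]. Shifting [b] by [pi] changes its
     sign, because [2 * pi] is a period, so it is zero. *)
  move=> hz; have H b : F b z - F (b + pi) z = F 0 z - F (0 + pi) z.
    by rewrite -!FN //; apply: alt_refl_const; rewrite ?hN.
  by have := H (0 + pi); rewrite per2 // => h; have := H a; lra.
have Fc a z : dot z z = 1 -> F a z = F 0 z by exact: flip_invariant.
have Fev z : dot z z = 1 -> F 0 (- z) = F 0 z by move=> hz; rewrite FN // Fc.
have Fcst a z : dot z z = 1 -> F a z = F th y.
  by move=> hz; rewrite Fc // (Fc th) //; exact: eigen_even_const.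
have [E fr] := frame_exists hy.
(* [F] is now constant, so its [lap] is [0], whereas the eigenvalue equation gives [- mu * F]. *)
have l0 : lap F th y E 0.
  exists 0, (fun=> 0); split; last by rewrite big1 // addr0.
    exists 0; have -> : (fun t => F (th + t) y) = (fun=> F th y).
      by apply/funext => t; exact: Fcst.
    exact: jet_cst.
  move=> i; exists 0; have [? ?] := frame_row i fr.
  have -> : (fun t => F th (arc y (row i E) t)) = (fun=> F th y).
    by apply/funext => t; rewrite Fcst // dot_arc.
  exact: jet_cst.
have := lap_unique l0 (eF.2 th y E fr) => /esym/eqP.
by rewrite mulf_eq0 oppr_eq0 (negbTE mu0) => /eqP.
Qed.

End Rigidity.

(** * Curves and smooth functions *)

Section CurveCalculus.
Context {R : realType}.

Lemma is_derive_comp_diff (V W : normedModType R) (g : R -> V) (h : V -> W)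
    (t : R) v : is_derive (t : R) 1 g v -> differentiable h (g t) ->
  is_derive (t : R) 1 (fun s => h (g s)) ('D_v h (g t)).
Proof.
move=> dg dh; have dg' : differentiable g t by apply/derivable1_diffP; case: dg.
apply: DeriveDef; first exact/derivable1_diffP/differentiable_comp.
rewrite deriveE; last exact: differentiable_comp.
rewrite (diff_comp dg' dh) /= -[in 'd g t 1]deriveE // derive_val.
by rewrite deriveE.
Qed.

Lemma is_derive_scalel (V : normedModType R) (c : R -> R) (t c' : R) (u : V) :
  is_derive (t : R) 1 c c' -> is_derive (t : R) 1 (fun s => c s *: u) (c' *: u).
Proof.
move=> dc; have := @is_derive_comp_diff _ _ c (fun x : R => x *: u) t c' dc.
have -> : 'D_c' (fun x : R => x *: u) (c t) = c' *: u.
  by rewrite deriveE // diff_val.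
by apply.
Qed.

Lemma is_derive_coord n (g : R -> 'rV[R]_n) (t : R) v i :
  is_derive (t : R) 1 g v -> is_derive (t : R) 1 (fun s => g s 0 i) (v 0 i).
Proof.
move=> [dg <-]; apply: DeriveDef; first exact: (derivable_mxP _ _ _).1.
by rewrite derive_mx // mxE.
Qed.

Lemma is_derive_dot n (f g : R -> 'rV[R]_n) (t : R) u v :
  is_derive (t : R) 1 f u -> is_derive (t : R) 1 g v ->
  is_derive (t : R) 1 (fun s => dot (f s) (g s)) (dot u (g t) + dot (f t) v).
Proof.
move=> df dg.
have -> : (fun s => dot (f s) (g s)) = \sum_(i < n) (fun s => f s 0 i * g s 0 i).
  by apply/funext => z; rewrite dotE fct_sumE.
rewrite !dotE -big_split /=; apply: is_derive_sum => i.
have dfi := is_derive_coord i df; have dgi := is_derive_coord i dg.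
apply: is_derive_eq; rewrite /GRing.scale /=; ring.
Qed.

Lemma is_derive_mulmx n m (A : 'M[R]_(n, m)) (f : R -> 'rV[R]_n) (t : R) u :
  is_derive (t : R) 1 f u -> is_derive (t : R) 1 (fun s => f s *m A) (u *m A).
Proof.
move=> df.
have -> : (fun s => f s *m A) = \sum_(i < n) (fun s => f s 0 i *: row i A).
  by apply/funext => z; rewrite fct_sumE mulmx_sum_row.
rewrite mulmx_sum_row; apply: is_derive_sum => i; apply: is_derive_scalel.
exact: is_derive_coord.
Qed.

Lemma is_derive_trig n (a : R) (u v : 'rV[R]_n) (t : R) :
  is_derive (t : R) 1 (fun s => cos (a * s) *: u + sin (a * s) *: v)
    (cos (a * t) *: (a *: v) + sin (a * t) *: (- a *: u)).
Proof.
have dc : is_derive (t : R) 1 (fun s => cos (a * s)) (- a * sin (a * t)).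
  have := is_derive_cos_affine a 0 t; rewrite addr0.
  by congr is_derive; apply/funext => s; rewrite addr0.
have ds : is_derive (t : R) 1 (fun s => sin (a * s)) (a * cos (a * t)).
  have := is_derive_cos_affine a (- (pi / 2)) t.
  rewrite sinBpihalf mulrN mulNr opprK.
  by congr is_derive; apply/funext => s; rewrite cosBpihalf.
have := is_deriveD (is_derive_scalel u dc) (is_derive_scalel v ds).
congr is_derive; apply/rowP => j; rewrite !mxE; ring.
Qed.

Definition grad n (h : 'rV[R]_n -> R) q := \row_j 'D_(delta_mx 0 j) h q.

Lemma derive_grad n (h : 'rV[R]_n -> R) q v : differentiable h q ->
  'D_v h q = dot (grad h q) v.
Proof.
move=> dh; rewrite deriveE // {1}(row_sum_delta v) linear_sum dotE.
by apply: eq_bigr => i _; rewrite linearZ /= mxE deriveE // [LHS]mulrC.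
Qed.

Lemma differentiable_grad n (h : 'rV[R]_n -> R) q :
  (forall v, differentiable (fun x => 'D_v h x) q) -> differentiable (grad h) q.
Proof.
move=> dh; have -> : grad h =
    \sum_(j < n) (fun x => 'D_(delta_mx 0 j) h x *: (delta_mx 0 j : 'rV[R]_n)).
  apply/funext => x; rewrite fct_sumE [LHS]row_sum_delta.
  by apply: eq_bigr => j _; rewrite mxE.
by apply: differentiable_sum => j; exact: differentiableZl.
Qed.

End CurveCalculus.

Section Smoothness.
Context {R : realType}.

Lemma Ck_subset (V W : normedModType R) k (U U' : set V) (f : V -> W) :
  U `<=` U' -> Ck k U' f -> Ck k U f.
Proof.
move=> UU'; elim: k f => [|k IH] f /=; first by move=> h x /UU'; exact: h.
by move=> [h1 h2]; split=> [x /UU'|v]; [exact: h1|exact: IH].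
Qed.

Lemma CkD (V W : normedModType R) k (f g : V -> W) :
  Ck k setT f -> Ck k setT g -> Ck k setT (fun x => f x + g x).
Proof.
elim: k f g => [|k IH] f g /=.
  by move=> cf cg x _; apply: cvgD; [exact: cf|exact: cg].
move=> [df Df] [dg Dg]; split=> [x _|v].
  by apply: differentiableD; [exact: df|exact: dg].
have -> : (fun x => 'D_v (fun x => f x + g x) x) = (fun x => 'D_v f x + 'D_v g x).
  apply/funext => x; rewrite (@deriveD _ _ _ f g) //.
    by apply: diff_derivable; exact: df.
  by apply: diff_derivable; exact: dg.
exact: IH.
Qed.

(** Curves of this form are closed under differentiation, so the induction runs over all [u] and [v]
    at once. *)
Lemma Ck_trig n k (a : R) (u v : 'rV[R]_n) :
  Ck k setT (fun t : R => cos (a * t) *: u + sin (a * t) *: v).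
Proof.
have df (u' v' : 'rV[R]_n) (t : R) :
    differentiable (fun t : R => cos (a * t) *: u' + sin (a * t) *: v') t.
  by apply/derivable1_diffP; case: (is_derive_trig a u' v' t).
elim: k u v => [|k IH] u v /=; first by move=> t _; exact: differentiable_continuous.
split=> [t _|w]; first exact: df.
have -> : (fun t : R => 'D_w (fun t => cos (a * t) *: u + sin (a * t) *: v) t) =
    (fun t => cos (a * t) *: (w *: (a *: v)) + sin (a * t) *: (w *: (- a *: u))).
  apply/funext => t; rewrite deriveE // -[w in LHS]mulr1 -[w * 1]/(w *: 1).
  rewrite linearZ /= -deriveE // (derive_val (is_derive := is_derive_trig a u v t)).
  by apply/rowP => j; rewrite !mxE; ring.
exact: IH.
Qed.

Lemma Ck_cst (V W : normedModType R) k (c : W) : Ck k setT (fun _ : V => c).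
Proof.
elim: k c => [|k IH] c /=; first by move=> x _; exact: cvg_cst.
split=> [x _|v]; first exact: differentiable_cst.
have -> : (fun x => 'D_v (fun=> c) x) = (fun _ : V => 0 : W).
  by apply/funext => x; rewrite (@derive_cst _ _ _ c).
exact: IH.
Qed.

(** Computed along the line [x + t *: v]. The affine term [e] lets one formula serve linear
    functions and quadratic forms. *)
Lemma derive_quadratic n (A : 'M[R]_n) (e x v : 'rV[R]_n) :
  'D_v (fun x => dot (x *m A + e) x) x = dot (v *m A) x + dot (x *m A + e) v.
Proof.
have dh : differentiable (fun x => dot (x *m A + e) x) x.
  apply: differentiable_dot => //; apply: differentiableD => //.
  exact: differentiable_mulmx.
have dg : is_derive (0 : R) 1 (fun t : R => x + t *: v) v.
  have dv : is_derive (0 : R) 1 (fun t : R => t *: v) (1 *: v).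
    by apply: is_derive_scalel.
  by have := is_deriveD (is_derive_cst x (0 : R) 1) dv; rewrite add0r scale1r.
have := @is_derive_comp_diff _ _ _ _ (fun x => dot (x *m A + e) x) _ _ dg.
rewrite scale0r addr0 => /(_ dh) h1.
have dgA : is_derive (0 : R) 1 (fun t : R => (x + t *: v) *m A + e) (v *m A).
  have := is_deriveD (is_derive_mulmx A dg) (is_derive_cst e (0 : R) 1).
  by rewrite addr0.
have := is_derive_dot dgA dg; rewrite scale0r addr0 => h2.
exact: is_derive_unique h1 h2.
Qed.

Lemma smooth_linear n (e : 'rV[R]_n) : smooth setT (fun x => dot e x).
Proof.
have E v x : 'D_v (fun x => dot e x) x = dot e v.
  have := derive_quadratic 0 e x v; rewrite !mulmx0 dot0l !add0r => <-.
  by congr ('D_v _ x); apply/funext => z; rewrite mulmx0 add0r.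
have df x : differentiable (fun x => dot e x) x by exact: differentiable_dot.
case=> [x _|k /=]; first exact: differentiable_continuous.
split=> // v; have -> : (fun x => 'D_v (fun x => dot e x) x) = (fun=> dot e v).
  exact/funext.
exact: Ck_cst.
Qed.

Lemma smooth_quadratic n (A : 'M[R]_n) : smooth setT (fun x => dot (x *m A) x).
Proof.
have df x : differentiable (fun x => dot (x *m A) x) x.
  by apply: differentiable_dot => //; exact: differentiable_mulmx.
case=> [x _|k /=]; first exact: differentiable_continuous.
split=> // v; have -> : (fun x => 'D_v (fun x => dot (x *m A) x) x) =
    (fun x => dot (v *m A + v *m A^T) x).
  apply/funext => x; have := derive_quadratic A 0 x v; rewrite addr0.
  have -> : (fun x => dot (x *m A + 0) x) = (fun x => dot (x *m A) x).
    by apply/funext => z; rewrite addr0.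
  by move=> ->; rewrite dotDl (dot_mulmx x) (dotC x).
exact: smooth_linear.
Qed.

End Smoothness.

(** * Clifford systems and the parametrization of M2 *)

Section GramSchmidt.
Context {R : realType}.

Lemma orthonormal_row_free m n (B : 'M[R]_(m, n)) :
  B *m B^T = 1%:M -> row_free B.
Proof. by move=> h; apply/row_freeP; exists B^T. Qed.

(** Gram-Schmidt: while the rank of [A] exceeds [s], some row of [A] lies outside the span of [B];
    its component orthogonal to [B] is normalized and added. *)
Lemma orthonormal_subfamily m n (A : 'M[R]_(m, n)) s : (s <= \rank A)%N ->
  exists B : 'M[R]_(s, n), B *m B^T = 1%:M /\ (B <= A)%MS.
Proof.
elim: s => [|s IH] hs.
  by exists 0; split; [apply/matrixP => -[]|exact: sub0mx].
have [B [BB BA]] := IH (ltnW hs).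
have /row_subPn[i hi] : ~~ (A <= B)%MS.
  apply/negP => /mxrankS; rewrite leqNgt => /negP; apply.
  by rewrite (leq_ltn_trans _ hs) // rank_leq_row.
pose w := row i A - row i A *m B^T *m B.
have w0 : w != 0.
  apply: contra hi; rewrite subr_eq0 => /eqP ->; exact: submxMl.
have wB : w *m B^T = 0 by rewrite mulmxBl -!mulmxA BB mulmx1 subrr.
have wA : (w <= A)%MS.
  apply: addmx_sub; first exact: row_sub.
  by rewrite eqmx_opp (submx_trans (submxMl _ _)).
pose e := (Num.sqrt (dot w w))^-1 *: w.
have ee : e *m e^T = 1%:M.
  by rewrite [LHS]mx11_scalar -[X in X%:M]/(dot e e) dot_normalize.
have eB : e *m B^T = 0 by rewrite -scalemxAl wB scaler0.
have Be : B *m e^T = 0 by rewrite -[LHS]trmxK trmx_mul trmxK eB trmx0.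
pose C : 'M[R]_(1 + s, n) := col_mx e B.
have CC : C *m C^T = 1%:M.
  by rewrite tr_col_mx mul_col_row ee eB BB Be (@scalar_mx_block _ 1 s 1).
have CA : (C <= A)%MS by rewrite col_mx_sub BA andbT scalemx_sub.
by exists C.
Qed.

Lemma orthonormal_basis_exists m n (A : 'M[R]_(m, n)) :
  exists B : 'M[R]_(\rank A, n), B *m B^T = 1%:M /\ (B :=: A)%MS.
Proof.
have [B [BB BA]] := orthonormal_subfamily (leqnn (\rank A)).
exists B; split=> //; apply/eqmxP; rewrite -(geq_leqif (mxrank_leqif_eq BA)).
by have /eqP -> := orthonormal_row_free BB.
Qed.

End GramSchmidt.

Section Clifford.
Context {R : realType} {n : nat} (P0 P1 : 'M[R]_n).
Hypotheses (tr0 : P0^T = P0) (tr1 : P1^T = P1).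
Hypotheses (sq0 : P0 *m P0 = 1%:M) (sq1 : P1 *m P1 = 1%:M).
Hypothesis anti : P0 *m P1 = - (P1 *m P0).

(* Locked, since rewriting with the associativity of [*m] would unfold it. *)
Definition cpx := locked (P0 *m P1).
Local Notation J := cpx.

Lemma cpxE : P0 *m P1 = J. Proof. by rewrite /cpx -lock. Qed.

(** This is [exp (t J)], as [J] squares to [- 1%:M]. *)
Definition rot (t : R) : 'M[R]_n := locked ((cos t)%:M + sin t *: J).

Lemma rotE t : rot t = (cos t)%:M + sin t *: J.
Proof. by rewrite /rot -lock. Qed.

Lemma cpx_sq : J *m J = - 1%:M.
Proof.
by rewrite -!cpxE {2}anti mulmxN mulmxA -(mulmxA P0) sq1 mulmx1 sq0.
Qed.

Lemma tr_cpx : J^T = - J.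
Proof. by rewrite -cpxE trmx_mul tr0 tr1 anti opprK. Qed.

Lemma P0_cpx : P0 *m J = P1.
Proof. by rewrite -cpxE mulmxA sq0 mul1mx. Qed.

Lemma cpx_P0 : J *m P0 = - P1.
Proof. by rewrite -cpxE -mulmxA -[P1 *m P0]opprK -anti mulmxN mulmxA sq0 mul1mx. Qed.

Lemma rot0 : rot 0 = 1%:M.
Proof. by rewrite !rotE cos0 sin0 scale0r addr0. Qed.

Lemma rotD a b : rot a *m rot b = rot (a + b).
Proof.
rewrite !rotE cosD sinD mulmxDl !mulmxDr mul_scalar_mx scale_scalar_mx.
rewrite mul_scalar_mx scalerA mul_mx_scalar scalerA -scalemxAl -scalemxAr cpx_sq.
apply/matrixP => i j; rewrite !mxE; ring.
Qed.

Lemma tr_rot a : (rot a)^T = rot (- a).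
Proof.
by rewrite !rotE linearD /= tr_scalar_mx linearZ /= tr_cpx cosN sinN scalerN scaleNr.
Qed.

Lemma rot_P0 a : rot a *m P0 = P0 *m rot (- a).
Proof.
rewrite !rotE mulmxDl mulmxDr mul_scalar_mx mul_mx_scalar -scalemxAl -scalemxAr.
by rewrite cpx_P0 P0_cpx cosN sinN scalerN scaleNr.
Qed.

Lemma mulmx_rot m (A : 'M[R]_(m, n)) t :
  A *m rot t = cos t *: A + sin t *: (A *m J).
Proof. by rewrite !rotE mulmxDr mul_mx_scalar -scalemxAr. Qed.

Lemma dot_cpx x : dot x (x *m J) = 0.
Proof.
have : dot x (x *m J) = - dot x (x *m J).
  by rewrite {1}dotC dot_mulmx tr_cpx mulmxN dotNr.
by move=> h; lra.
Qed.

Lemma dot_cpx2 x y : dot (x *m J) (y *m J) = dot x y.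
Proof. by rewrite dot_mulmx tr_cpx -mulmxA mulmxN cpx_sq opprK mulmx1. Qed.

(** Conjugation by [P1] exchanges [1 + P0] and [1 - P0], so their ranks agree. Their product is [0]
    and their sum is twice the identity, which bounds the sum of ranks from both sides. *)
Lemma clifford_rank : (\rank (1%:M + P0)%R + \rank (1%:M + P0)%R)%N = n.
Proof.
have E : \rank (1%:M + P0)%R = \rank (1%:M - P0)%R.
  have u1 : P1 \in unitmx by have [] := mulmx1_unit sq1.
  have -> : 1%:M - P0 = P1 *m (1%:M + P0) *m P1.
    rewrite mulmxDr mulmx1 mulmxDl sq1 -[P1 *m P0]opprK -anti mulNmx -mulmxA sq1.
    by rewrite mulmx1.
  have fu : row_full P1 by rewrite row_full_unit.
  by rewrite mxrankMfree ?row_free_unit // (eqmxMfull _ fu).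
apply/eqP; rewrite eqn_leq {1}E {3}E; apply/andP; split.
  rewrite addnC; apply: mulmx0_rank_max.
  by rewrite mulmxDl mul1mx mulmxBr mulmx1 sq0 addrA subrK subrr.
apply: leq_trans (mxrank_add _ _).
rewrite addrACA subrr addr0 -mulr2n -scaler_nat mxrank_scale_nz ?pnatr_eq0 //.
by rewrite mxrank1.
Qed.

(** The rows of [B] are an orthonormal basis of the +1 eigenspace of [P0], which is the row space of
    [1 + P0]; [B^T *m B] is the orthogonal projection onto it. *)
Lemma clifford_basis d : n = (2 * d.+1)%N ->
  exists B : 'M[R]_(d.+1, n), B *m B^T = 1%:M /\ B^T *m B = 2^-1 *: (1%:M + P0).
Proof.
move=> hn; pose A := 1%:M + P0.
have rA : \rank A = d.+1.
  have := etrans clifford_rank hn; rewrite -/A addnn -mul2n => /eqP.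
  by rewrite eqn_mul2l => /eqP.
have [B [BB BA]] : exists B : 'M[R]_(d.+1, n), B *m B^T = 1%:M /\ (B :=: A)%MS.
  by rewrite -rA; exact: orthonormal_basis_exists.
exists B; split=> //.
have [D BE] : exists D, B = D *m A by apply/submxP; rewrite BA.
have [C AE] : exists C, A = C *m B by apply/submxP; rewrite BA.
have AA : A *m A = 2 *: A.
  rewrite /A mulmxDl mul1mx mulmxDr mulmx1 sq0 (addrC P0) -mulr2n scaler_nat //.
have trA : A^T = A by rewrite /A linearD /= trmx1 tr0.
have B1 : B *m A = 2 *: B by rewrite BE -mulmxA AA scalemxAr.
have A1 : A *m (B^T *m B) = A by rewrite AE -mulmxA (mulmxA B) BB mul1mx.
rewrite -/A -[in RHS]A1 -[RHS]trmxK linearZ /= !trmx_mul trmxK trA.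
by rewrite -mulmxA B1 -scalemxAr scalerA mulVf ?pnatr_eq0 // scale1r trmx_mul trmxK.
Qed.

Section Lift.
Context {d : nat} (B : 'M[R]_(d.+1, n)).
Hypotheses (BB : B *m B^T = 1%:M) (hB : B^T *m B = 2^-1 *: (1%:M + P0)).
Implicit Types (y z : 'rV[R]_d.+1) (x w : 'rV[R]_n) (th : R).

(** The point [exp (th J) y], with [y] given by its coordinates in the basis [B] of the
    eigenspace. *)
Definition lift_pt th y := y *m B *m rot th.

Lemma basis_P0 : B *m P0 = B.
Proof.
have : B *m (B^T *m B) = B by rewrite mulmxA BB mul1mx.
rewrite hB -scalemxAr mulmxDr mulmx1 => h.
have : B + B *m P0 = 2 *: B by rewrite -[in RHS]h scalerA divff ?pnatr_eq0 ?scale1r.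
by rewrite scaler_nat mulr2n => /addrI.
Qed.

(** [J] anticommutes with [P0], so it maps the +1 eigenspace into the orthogonal -1 eigenspace. *)
Lemma basis_cpx : B *m J *m B^T = 0.
Proof.
have : B *m J *m B^T = - (B *m J *m B^T).
  transitivity (B *m J *m (B *m P0)^T); first by rewrite basis_P0.
  rewrite trmx_mul tr0 mulmxA -(mulmxA B) cpx_P0 -P0_cpx.
  by rewrite mulmxN mulNmx (mulmxA B) basis_P0.
move=> h; apply/matrixP => i j; have := congr1 (fun M : 'M[R]_d.+1 => M i j) h.
by rewrite !mxE; lra.
Qed.

Lemma rot_cpx t : rot t *m J = J *m rot t.
Proof.
by rewrite !rotE mulmxDl mulmxDr mul_scalar_mx mul_mx_scalar -scalemxAl -scalemxAr.
Qed.

Lemma dot_rot t x w : dot (x *m rot t) (w *m rot t) = dot x w.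
Proof. by rewrite dot_mulmx tr_rot -mulmxA rotD subrr rot0 mulmx1. Qed.

Lemma dot_lift th y z : dot (lift_pt th y) (lift_pt th z) = dot y z.
Proof. by rewrite dot_rot dot_mulmx -mulmxA BB mulmx1. Qed.

Lemma dot_lift_cpx th y z : dot (lift_pt th y *m J) (lift_pt th z) = 0.
Proof.
rewrite /lift_pt -mulmxA rot_cpx mulmxA dot_rot dotC dot_mulmx -!mulmxA.
by rewrite (mulmxA B) basis_cpx mulmx0 dot0r.
Qed.

Lemma lift_P0 th y : lift_pt th y *m P0 =
  cos (2 * th) *: lift_pt th y - sin (2 * th) *: (lift_pt th y *m J).
Proof.
rewrite /lift_pt -mulmxA rot_P0 mulmxA -(mulmxA y) basis_P0.
rewrite (_ : - th = th + - (2 * th)); last by ring.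
by rewrite -rotD mulmxA [LHS]mulmx_rot cosN sinN scaleNr.
Qed.

Lemma lift_P1 th y : lift_pt th y *m P1 =
  cos (2 * th) *: (lift_pt th y *m J) + sin (2 * th) *: lift_pt th y.
Proof.
rewrite -[in LHS]P0_cpx mulmxA lift_P0 mulmxBl -!scalemxAl -[_ *m J *m J]mulmxA.
by rewrite cpx_sq mulmxN mulmx1 scalerN opprK.
Qed.

Lemma dot_lift_P0 th y z :
  dot (lift_pt th y *m P0) (lift_pt th z) = cos (2 * th) * dot y z.
Proof.
by rewrite lift_P0 dotDl dotNl !dotZl dot_lift dot_lift_cpx mulr0 subr0.
Qed.

Lemma dot_lift_P1 th y z :
  dot (lift_pt th y *m P1) (lift_pt th z) = sin (2 * th) * dot y z.
Proof.
by rewrite lift_P1 dotDl !dotZl dot_lift dot_lift_cpx mulr0 add0r.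
Qed.

Lemma lift_ptD th a y : lift_pt (th + a) y = lift_pt th y *m rot a.
Proof. by rewrite /lift_pt -rotD mulmxA. Qed.

Lemma lift_pt_pi th y : lift_pt (th + pi) (- y) = lift_pt th y.
Proof.
by rewrite lift_ptD mulmx_rot cospi sinpi scale0r addr0 /lift_pt !mulNmx scaleN1r opprK.
Qed.

(* At a point [x] of [M2] the matrix [quad_mx x] is the involution conjugate to
   [P0] that fixes [x]. *)
Definition quad_mx x := dot (x *m P0) x *: P0 + dot (x *m P1) x *: P1.

(** On the unit sphere the polynomial is [1] minus twice this sum of squares, so the second
    condition says that it equals [-1]. *)
Definition M2 : set 'rV[R]_n := [set x | dot x x = 1 /\
  dot (x *m P0) x ^+ 2 + dot (x *m P1) x ^+ 2 = 1].

Lemma lift_M2 th y : dot y y = 1 -> M2 (lift_pt th y).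
Proof.
move=> hy; split; first by rewrite dot_lift.
by rewrite dot_lift_P0 dot_lift_P1 hy !mulr1 cos2Dsin2.
Qed.

Lemma angle_exists (c s : R) : c ^+ 2 + s ^+ 2 = 1 ->
  exists a, c = cos a /\ s = sin a.
Proof.
move=> h; have c1 : -1 <= c <= 1.
  rewrite -ler_norml -(@ler_pXn2r _ 2) ?nnegrE // expr1n.
  by rewrite real_normK ?num_real // -h lerDl sqr_ge0.
have hc : cos (acos c) = c by rewrite acosK // in_itv.
have hs : sin (acos c) = `|s|.
  by rewrite sin_acos // -sqrtr_sqr; congr Num.sqrt; rewrite -h; ring.
have [s0|s0] := ger0P s.
  by exists (acos c); rewrite hc hs ger0_norm.
by exists (- acos c); rewrite cosN sinN hc hs ltr0_norm // opprK.
Qed.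

(** A point [x] of [M2] is fixed by the involution [quad_mx x], and rotating by half its angle turns
    this involution into [P0]. *)
Lemma M2_lift x : M2 x -> exists th y, dot y y = 1 /\ x = lift_pt th y.
Proof.
move=> [hx hcs]; have [a [ca sa]] := angle_exists hcs.
have xQ : x *m P0 *m rot a = x.
  have -> : x *m P0 *m rot a = x *m quad_mx x.
    rewrite mulmx_rot -(mulmxA x) P0_cpx mulmxDr -!scalemxAr.
    by rewrite -/(quad_mx x) /quad_mx -ca -sa.
  (* The squared length of [x *m quad_mx x - x] expands to [1 - (c ^+ 2 + s ^+ 2)], which is [0]. *)
  apply/eqP; rewrite -subr_eq0 -dot_eq0.
  rewrite /quad_mx mulmxDr -!scalemxAr !dot_lin !(dotC x (x *m _)).
  rewrite ![dot (x *m P0) (x *m P0)]dot_mulmx ![dot (x *m P1) (x *m P1)]dot_mulmx.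
  rewrite tr0 tr1 -!(mulmxA x) sq0 sq1 mulmx1 hx.
  rewrite (dotC (x *m P1) (x *m P0)) [dot (x *m P0) (x *m P1)]dot_mulmx.
  rewrite tr0 -mulmxA -[P1 *m P0]opprK -anti mulmxN dotNr cpxE dot_cpx.
  move: hcs; set c := dot _ _; set s := dot _ _ => hcs.
  by apply/eqP; rewrite oppr0; move: hcs; lra.
(* Moving [P0] past [rot] reverses the angle, hence the half angle. *)
pose e := x *m rot (- (a / 2)).
have eP0 : e *m P0 = e.
  rewrite /e -[in RHS]xQ -!mulmxA rot_P0 opprK rotD; congr (_ *m (_ *m rot _)).
  by field.
have eB : e *m B^T *m B = e.
  rewrite -mulmxA hB -scalemxAr mulmxDr mulmx1 eP0 -mulr2n -(scaler_nat 2 e).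
  by rewrite scalerA mulVf ?pnatr_eq0 // scale1r.
exists (a / 2), (e *m B^T); split.
  by rewrite dot_mulmx trmxK eB dot_rot.
by rewrite /lift_pt eB /e -mulmxA rotD addNr rot0 mulmx1.
Qed.

(* For [x] in [M2], the orthogonal projection onto the tangent space, which is
   spanned by [x J] and the orthogonal of [x] in the +1 eigenspace of
   [quad_mx x].  It depends polynomially on [x], so that [tgrad] below extends
   the gradient smoothly off [M2]. *)
Definition proj x w :=
  dot w (x *m J) *: (x *m J) + 2^-1 *: (w + w *m quad_mx x) - dot w x *: x.

(** An orthonormal basis of the tangent space: the velocity of the [rot] orbit, then the lifted
    sphere frame. *)
Definition tframe th y (E : 'M[R]_(d, d.+1)) : 'M[R]_(1 + d, n) :=
  col_mx (lift_pt th y *m J) (E *m B *m rot th).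

Lemma row_tframeL th y E : row (lshift d 0) (tframe th y E) = lift_pt th y *m J.
Proof. by apply/rowP => j; rewrite mxE col_mxEu. Qed.

Lemma row_tframeR th y E i :
  row (rshift 1 i) (tframe th y E) = lift_pt th (row i E).
Proof. by apply/rowP => j; rewrite mxE col_mxEd /lift_pt -!row_mul [RHS]mxE. Qed.

Lemma tframe_orthonormal th y E : frame y E ->
  tframe th y E *m (tframe th y E)^T = 1%:M.
Proof.
move=> fr; have [hy EE Ey _] := fr.
apply/matrixP => i j; rewrite -dot_row2 mxE.
case: (split_ordP i) => i' ->; case: (split_ordP j) => j' ->.
- by rewrite !ord1 row_tframeL dot_cpx2 dot_lift hy eqxx.
- by rewrite !ord1 row_tframeL row_tframeR dot_lift_cpx eq_lrshift.
- by rewrite !ord1 row_tframeL row_tframeR dotC dot_lift_cpx eq_rlshift.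
- by rewrite !row_tframeR dot_lift dot_row2 EE mxE (inj_eq (@rshift_inj _ _)).
Qed.

(** At a lifted point [quad_mx] is [P0 *m rot (2 * th)], so half of [1] plus it projects onto the
    rotated eigenspace; removing the [x] component leaves the lifted frame. *)
Lemma tframe_proj th y E w : frame y E ->
  w *m ((tframe th y E)^T *m tframe th y E) = proj (lift_pt th y) w.
Proof.
move=> [hy _ _ EE]; rewrite tr_col_mx mul_row_col mulmxDr dot_mulmx_tr.
rewrite /proj -addrA; congr (_ + _).
rewrite !trmx_mul -!mulmxA (mulmxA E^T) EE mulmxBl mul1mx !mulmxBr; congr (_ - _).
  have -> : quad_mx (lift_pt th y) = P0 *m rot (2 * th).
    by rewrite /quad_mx dot_lift_P0 dot_lift_P1 hy !mulr1 mulmx_rot P0_cpx.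
  rewrite (mulmxA B^T) hB tr_rot -scalemxAl -!scalemxAr; congr (_ *: _).
  rewrite mulmxDl mul1mx !mulmxDr rotD addNr rot0 mulmx1; congr (_ + _).
  rewrite (mulmxA (rot (- th))) rot_P0 opprK -mulmxA rotD.
  by congr (w *m (P0 *m rot _)); ring.
by rewrite -dot_mulmx_tr /lift_pt !trmx_mul !mulmxA.
Qed.

Lemma lift_ptZ th c y : lift_pt th (c *: y) = c *: lift_pt th y.
Proof. by rewrite /lift_pt -!scalemxAl. Qed.

(** * Riemannian geometry of M2 *)

Lemma lift_quad th y : dot y y = 1 ->
  lift_pt th y *m quad_mx (lift_pt th y) = lift_pt th y.
Proof.
move=> hy; rewrite mulmxDr -!scalemxAr dot_lift_P0 dot_lift_P1 hy lift_P0 lift_P1.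
move: (lift_pt th y *m J) => Y; move: (lift_pt th y) => X.
apply/rowP => j; rewrite !mxE -[RHS]mul1r -[in RHS](cos2Dsin2 (2 * th)); ring.
Qed.

Lemma M2_tframe x : M2 x -> exists T : 'M[R]_(1 + d, n),
  T *m T^T = 1%:M /\ forall w, proj x w = w *m (T^T *m T).
Proof.
move=> /M2_lift [th [y [hy ->]]]; have [E fr] := frame_exists hy.
exists (tframe th y E); split; first exact: tframe_orthonormal.
by move=> w; rewrite tframe_proj.
Qed.

Lemma projB x v w : proj x (v - w) = proj x v - proj x w.
Proof.
rewrite /proj !dot_lin mulmxBl.
move: (v *m quad_mx x) (w *m quad_mx x) (x *m J) => v' w' x'.
by apply/rowP => j; rewrite !mxE; ring.
Qed.

Lemma proj_idem x w : M2 x -> proj x (proj x w) = proj x w.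
Proof.
move=> /M2_tframe[T [TT h]].
by rewrite !h -!mulmxA (mulmxA T) TT mul1mx.
Qed.

Lemma dot_proj x v w : M2 x -> dot (proj x v) w = dot v (proj x w).
Proof. by move=> /M2_tframe[T [_ h]]; rewrite !h dot_mulmx trmx_mul trmxK. Qed.

Lemma curve_is_derive M (p : 'rV[R]_n) g :
  curve_in M p g -> is_derive (0 : R) 1 g (derive1 g 0).
Proof.
move=> [_ [e [e0 sg _]]]; have [dg _] := sg 1%N.
have : differentiable g 0 by apply: dg; rewrite /= in_itv /= oppr_lt0 e0.
by move=> /derivable1_diffP dg0; rewrite derive1E; exact: derivableP.
Qed.

Lemma curve_near M (p : 'rV[R]_n) g :
  curve_in M p g -> \forall t \near (0 : R), M (g t).
Proof.
move=> [_ [e [e0 _ Mg]]]; near=> t; apply: Mg; near: t.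
by apply: near_in_itvoo; rewrite in_itv /= oppr_lt0 e0.
Unshelve. all: by end_near. Qed.

Lemma dot_ext (u v : 'rV[R]_n) : (forall e, dot u e = dot v e) -> u = v.
Proof.
move=> h; apply/eqP; rewrite -subr_eq0 -dot_eq0 dotDl dotNl h subrr //.
Qed.

(* Differentiate [x *m quad_mx x = x], which holds on [M2], along a curve. *)
Lemma tangent_is_proj x v : tangent M2 x v -> M2 x -> proj x v = v.
Proof.
move=> [g [cg gv]] /M2_lift [th [y [hy xE]]].
have dg := curve_is_derive cg; rewrite gv in dg.
have Mg := curve_near cg; have g0 : g 0 = x by case: cg.
have vx : dot v x = 0.
  have h := is_derive_dot dg dg; rewrite g0 in h.
  have h1 : \forall t \near (0 : R), dot (g t) (g t) = 1.
    by near=> t; have [] : M2 (g t) by near: t.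
  have := is_derive_unique (near_eq_is_derive h1 h) (is_derive_cst (1 : R) (0 : R) 1).
  by rewrite (dotC x); lra.
have sym i P : P^T = P -> dot (i *m P) v = dot (v *m P) i.
  by move=> tP; rewrite dot_mulmx tP dotC.
apply: dot_ext => e.
have dP (P : 'M[R]_n) := is_derive_mulmx P dg.
have dcs (P : 'M[R]_n) : is_derive (0 : R) 1
    (fun t => dot (g t *m P) (g t) * dot (g t *m P) e)
    (dot (x *m P) x * dot (v *m P) e +
     (dot (v *m P) x + dot (x *m P) v) * dot (x *m P) e).
  have h1 := is_derive_dot (dP P) dg.
  have h2 := is_derive_dot (dP P) (is_derive_cst e (0 : R) 1).
  rewrite dot0r addr0 g0 in h1 h2.
  apply: is_derive_eq; rewrite g0 /GRing.scale /=; ring.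
have he : is_derive (0 : R) 1 (fun t => dot (g t) e) (dot v e).
  have := is_derive_dot dg (is_derive_cst e (0 : R) 1).
  by rewrite dot0r addr0.
have hs := is_deriveD (dcs P0) (dcs P1).
have hE : \forall t \near (0 : R), dot (g t *m P0) (g t) * dot (g t *m P0) e +
    dot (g t *m P1) (g t) * dot (g t *m P1) e = dot (g t) e.
  near=> t; have /M2_lift[a [z [hz ->]]] : M2 (g t) by near: t.
  rewrite -[in RHS](lift_quad a hz) /quad_mx mulmxDr -!scalemxAr.
  by rewrite dotDl !dotZl.
have := is_derive_unique (near_eq_is_derive hE hs) he.
rewrite !sym //.
have -> : dot (v *m P0) x = - sin (2 * th) * dot v (x *m J).
  rewrite dot_mulmx tr0 xE lift_P0 -xE dotDr dotNr !dotZr vx; ring.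
have -> : dot (v *m P1) x = cos (2 * th) * dot v (x *m J).
  rewrite dot_mulmx tr1 xE lift_P1 -xE dotDr !dotZr vx; ring.
have -> : dot (x *m P0) e =
    cos (2 * th) * dot x e - sin (2 * th) * dot (x *m J) e.
  by rewrite xE lift_P0 dotDl dotNl !dotZl.
have -> : dot (x *m P1) e =
    cos (2 * th) * dot (x *m J) e + sin (2 * th) * dot x e.
  by rewrite xE lift_P1 dotDl !dotZl.
rewrite /proj vx scale0r subr0 /quad_mx mulmxDr -!scalemxAr.
rewrite !(dotDl, dotZl).
move: (dot v _) (dot (x *m J) e) (cos2Dsin2 (2 * th)) => m Y cs.
set A0 := _ * dot (v *m P0) e; set A1 := _ * dot (v *m P1) e => Eq.
(* The sum [A0 + A1] is [dot (v *m quad_mx x) e], so [v *m quad_mx x] differs from [v] by [2 * m]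
   times [x *m J], which the first term of [proj] compensates. *)
have -> : A0 + A1 = dot v e -
    2 * m * Y * (cos (2 * th) ^+ 2 + sin (2 * th) ^+ 2).
  by rewrite -Eq; ring.
by rewrite cs; field.
Unshelve. all: by end_near. Qed.

(* The curve is a screw motion, a great circle of S^d composed with [rot]; its
   products of trigonometric functions are linearized so that [Ck_trig] applies. *)
Lemma proj_is_tangent x v : M2 x -> proj x v = v -> tangent M2 x v.
Proof.
move=> /M2_lift[th [y [hy xE]]] pv.
have [E fr] := frame_exists hy; have [_ _ Ey _] := fr.
pose a := dot v (x *m J); pose z := v *m (E *m B *m rot th)^T *m E.
have vE : v = a *: (x *m J) + lift_pt th z.
  rewrite -[LHS]pv xE -(tframe_proj _ _ fr) tr_col_mx mul_row_col mulmxDr.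
  by rewrite dot_mulmx_tr -xE /lift_pt /z !mulmxA.
have yz : dot y z = 0.
  have yE : y *m E^T = 0 by rewrite -[LHS]trmxK trmx_mul trmxK Ey trmx0.
  by rewrite dotC /z dot_mulmx yE dot0r.
(* Speed and direction of the sphere component. If [w = 0], the inverse is [0] by convention and
   [z'] is [0]. *)
pose w := Num.sqrt (dot z z); pose z' := w^-1 *: z.
have wz : w *: z' = z.
  rewrite scalerA; have [w0|w0] := eqVneq w 0; last by rewrite divff ?scale1r.
  rewrite w0 mul0r scale0r; apply/esym/eqP; rewrite -dot_eq0.
  by move/eqP: w0; rewrite sqrtr_eq0 => h; rewrite eq_le h dot_ge0.
have hz t : dot (arc y z' (w * t)) (arc y z' (w * t)) = 1.
  have [w0|w0] := eqVneq w 0.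
    by rewrite w0 mul0r arc0.
  apply: dot_arc => //; last by rewrite dotZr yz mulr0.
  apply: dot_normalize.
  by apply: contra w0 => /eqP z0; rewrite /w z0 dot0l sqrtr0.
pose q := lift_pt th z'.
pose u1 := 2^-1 *: (x - q *m J); pose v1 := 2^-1 *: (x *m J + q).
pose u2 := 2^-1 *: (x + q *m J); pose v2 := 2^-1 *: (q - x *m J).
pose g (t : R) := (cos ((w + a) * t) *: u1 + sin ((w + a) * t) *: v1) +
  (cos ((w - a) * t) *: u2 + sin ((w - a) * t) *: v2).
have gE t : g t = lift_pt (th + a * t) (arc y z' (w * t)).
  rewrite lift_ptD mulmx_rot {1 2}/lift_pt !arc_mulmx -/(lift_pt th y).
  rewrite -/(lift_pt th z') -xE -/q /g /u1 /v1 /u2 /v2.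
  have -> : (w + a) * t = w * t + a * t by ring.
  have -> : (w - a) * t = w * t - a * t by ring.
  rewrite cosD sinD cosB sinB.
  move: (cos _) (sin _) (cos _) (sin _) (x *m J) (q *m J) => c1 s1 c2 s2 x' q'.
  by apply/rowP => j; rewrite !mxE; field.
exists g; split.
  split; first by rewrite gE mulr0 addr0 mulr0 arc0 xE.
  exists 1; split=> // [k|t _]; last by rewrite gE; apply: lift_M2; exact: hz.
  by apply: (@Ck_subset _ _ _ _ _ setT) => //; apply: CkD; exact: Ck_trig.
have d1 := is_derive_trig (w + a) u1 v1 0.
have d2 := is_derive_trig (w - a) u2 v2 0.
rewrite derive1E (derive_val (is_derive := is_deriveD d1 d2)).
rewrite !mulr0 cos0 sin0 !scale0r !addr0 !scale1r vE -wz.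
have alg (x' q' : 'rV[R]_n) : (w + a) *: (2^-1 *: (x' + q')) +
    (w - a) *: (2^-1 *: (q' - x')) = a *: x' + w *: q'.
  by apply/rowP => j; rewrite !mxE; field.
by rewrite lift_ptZ; exact: alg.
Qed.

Lemma tangentE x v : M2 x -> tangent M2 x v <-> proj x v = v.
Proof.
by move=> Mx; split=> h; [exact: tangent_is_proj|exact: proj_is_tangent].
Qed.

Lemma tangent_projE x w : M2 x -> tangent_proj M2 x w = proj x w.
Proof.
move=> Mx; apply: get_unique.
  split; first by apply/tangentE => //; exact: proj_idem.
  move=> v /tangent_is_proj/(_ Mx) <-.
  by rewrite -dot_proj // projB proj_idem // subrr dot0l.
move=> u [/tangent_is_proj/(_ Mx) pu hu]; apply/esym/eqP.
rewrite -subr_eq0 -dot_eq0.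
have h : proj x (proj x w - u) = proj x w - u by rewrite projB proj_idem // pu.
have h2 : proj x w - u = proj x (w - u) by rewrite projB pu.
by rewrite {1}h2 dot_proj // h hu //; exact/tangentE.
Qed.

(** * Gradient and divergence through a local extension *)

Section Extension.
Variables (f h : 'rV[R]_n -> R) (U : set 'rV[R]_n).
Hypotheses (oU : open U) (sh : smooth U h).
Hypothesis fh : forall x, U x -> M2 x -> h x = f x.

Definition tgrad x := proj x (grad h x).

Lemma extension_diff x : U x -> differentiable h x.
Proof. by have [dh _] := sh 1%N; exact: dh. Qed.

Lemma tgrad_derive x v : U x -> M2 x -> proj x v = v ->
  'D_v h x = dot (tgrad x) v.
Proof.
move=> Ux Mx pv; rewrite derive_grad; last exact: extension_diff.
by rewrite /tgrad dot_proj // pv.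
Qed.

Lemma tgrad_diff x : U x -> differentiable tgrad x.
Proof.
move=> Ux; have dg : differentiable (grad h) x.
  apply: differentiable_grad => v.
  by have [_ dh] := sh 2%N; have [+ _] := dh v; exact.
have dm (A : 'M[R]_n) (f' : 'rV[R]_n -> 'rV[R]_n) : differentiable f' x ->
    differentiable (fun x => f' x *m A) x.
  move=> df; apply: (@differentiable_comp _ _ _ _ f' (fun x => x *m A)) => //.
  exact: differentiable_mulmx.
have ds (c : 'rV[R]_n -> R) (f' : 'rV[R]_n -> 'rV[R]_n) : differentiable c x ->
    differentiable f' x -> differentiable (fun x => c x *: f' x) x.
  move=> dc df; have -> : (fun x => c x *: f' x) =
      \sum_(j < n) (fun x => (c x * f' x 0 j) *: (delta_mx 0 j : 'rV[R]_n)).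
    apply/funext => z; rewrite fct_sumE {1}(row_sum_delta (f' z)) scaler_sumr.
    by apply: eq_bigr => j _; rewrite scalerA.
  apply: differentiable_sum => j; apply: differentiableZl; apply: differentiableM => //.
  apply: (@differentiable_comp _ _ _ _ f' (fun M : 'rV[R]_n => M 0 j)) => //.
  exact: differentiable_coord.
have di : differentiable (fun x : 'rV[R]_n => x) x by [].
have dJ := dm J _ di; have d0 := dm P0 _ di; have d1 := dm P1 _ di.
have -> : tgrad = (fun x => dot (grad h x) (x *m J) *: (x *m J)
    + (2^-1 *: (grad h x + (dot (x *m P0) x *: (grad h x *m P0)
                         + dot (x *m P1) x *: (grad h x *m P1)))
    - dot (grad h x) x *: x)).
  apply/funext => z; rewrite /tgrad /proj /quad_mx mulmxDr -!scalemxAr.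
  exact/esym/addrA.
apply: differentiableD; first by apply: ds => //; exact: differentiable_dot.
apply: differentiableB; last by apply: ds => //; exact: differentiable_dot.
apply: differentiableZ; apply: differentiableD => //; apply: differentiableD.
  by apply: ds; [exact: differentiable_dot|exact: dm].
by apply: ds; [exact: differentiable_dot|exact: dm].
Qed.

Lemma curve_near_open x g : U x -> curve_in M2 x g ->
  \forall t \near (0 : R), U (g t).
Proof.
move=> Ux cg; have [dg _] := curve_is_derive cg.
have /derivable1_diffP/differentiable_continuous cg0 := dg.
have [g0 _] := cg; apply: (cg0 U); rewrite g0; exact: open_nbhs_nbhs.
Qed.

Lemma curve_derive_f x g : U x -> M2 x -> curve_in M2 x g ->
  derive1 (f \o g) 0 = dot (tgrad x) (derive1 g 0).
Proof.
move=> Ux Mx cg; have dg := curve_is_derive cg; have [g0 _] := cg.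
have pv : proj x (derive1 g 0) = derive1 g 0.
  by apply: tangent_is_proj => //; exists g.
rewrite -tgrad_derive // derive1E.
have dh : differentiable h (g 0) by rewrite g0; exact: extension_diff.
have := is_derive_comp_diff dg dh; rewrite g0 => hd.
have fg : \forall t \near (0 : R), h (g t) = (f \o g) t.
  have n1 := curve_near_open Ux cg; have n2 := curve_near cg.
  by near=> t; apply: fh; near: t.
exact: (@derive_val _ _ _ _ _ _ _ (near_eq_is_derive fg hd)).
Unshelve. all: by end_near. Qed.

(** For uniqueness, the difference of two candidates is tangent, so it is tested against a curve
    having it as velocity. *)
Lemma gradientE x : U x -> M2 x -> gradient M2 f x = tgrad x.
Proof.
move=> Ux Mx; apply: get_unique.
  split; first by apply/tangentE => //; exact: proj_idem.
  by move=> g cg; exact: curve_derive_f.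
move=> w [/tangent_is_proj/(_ Mx) pw hw]; apply/eqP.
rewrite -subr_eq0 -dot_eq0; set u := w - _.
have /proj_is_tangent : proj x u = u by rewrite projB pw proj_idem.
move=> /(_ Mx)[g [cg gu]]; have := hw g cg; rewrite (curve_derive_f Ux) // gu => E.
have -> : dot u u = dot w u - dot (tgrad x) u by rewrite {1}/u dotDl dotNl.
by rewrite E subrr.
Qed.

Lemma ambient_derivativeE x v : U x -> M2 x -> proj x v = v ->
  ambient_derivative M2 (gradient M2 f) x v = 'D_v tgrad x.
Proof.
move=> Ux Mx pv.
have H g : curve_in M2 x g -> derive1 g 0 = v ->
    derive1 (gradient M2 f \o g) 0 = 'D_v tgrad x.
  move=> cg gv; have dg := curve_is_derive cg; have [g0 _] := cg.
  have dX : differentiable tgrad (g 0) by rewrite g0; exact: tgrad_diff.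
  have := is_derive_comp_diff dg dX; rewrite g0 gv derive1E => hd.
  have fg : \forall t \near (0 : R), tgrad (g t) = (gradient M2 f \o g) t.
    have n1 := curve_near_open Ux cg; have n2 := curve_near cg.
    by near=> t; rewrite /= gradientE //; near: t.
  exact: (@derive_val _ _ _ _ _ _ _ (near_eq_is_derive fg hd)).
apply: get_unique.
  have [g [cg gv]] := proj_is_tangent Mx pv.
  by exists g; split=> //; exact: H.
by move=> w [g [cg gv <-]]; exact: H.
Unshelve. all: by end_near. Qed.

(** Each sum is the trace of [A] against [E^T *m E], the orthogonal projection onto the tangent
    space, which is the same for all orthonormal bases. The projection in the connection disappears
    against a tangent row. *)
Lemma divergenceE x (T : 'M[R]_(1 + d, n)) : U x -> M2 x ->
  T *m T^T = 1%:M -> (forall w, proj x w = w *m (T^T *m T)) ->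
  divergence M2 (gradient M2 f) x =
    \sum_i dot ('D_(row i T) tgrad x) (row i T).
Proof.
move=> Ux Mx TT pT; pose A := lin1_mx ('d tgrad x).
have DA v : 'D_v tgrad x = v *m A.
  by rewrite deriveE; [rewrite mul_rV_lin1|exact: tgrad_diff].
have trE k (E : 'M[R]_(k, n)) :
    \sum_i dot ('D_(row i E) tgrad x) (row i E) = \tr (A *m (E^T *m E)).
  rewrite mulmxA mxtrace_mulC mulmxA /mxtrace; apply: eq_bigr => i _.
  by rewrite DA -row_mul dot_row2.
have val k (E : 'M[R]_(k, n)) : orthonormal_basis (tangent M2 x) E ->
    \sum_i dot (covariant_derivative M2 (gradient M2 f) x (row i E)) (row i E) =
    \sum_i dot ('D_(row i T) tgrad x) (row i T).
  move=> [EE hE].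
  have rowE i : proj x (row i E) = row i E.
    by apply: tangent_is_proj => //; apply/hE; exact: row_sub.
  rewrite (eq_bigr (fun i => dot ('D_(row i E) tgrad x) (row i E))); last first.
    move=> i _; rewrite /covariant_derivative tangent_projE //.
    by rewrite ambient_derivativeE // dot_proj // rowE.
  rewrite !trE; congr (\tr (A *m _)).
  have h1 : E *m (T^T *m T) = E.
    by apply/row_matrixP => i; rewrite row_mul -pT rowE.
  have h2 : T *m (E^T *m E) = T.
    have /submxP[D ->] : (T <= E)%MS.
      apply/row_subP => i; apply/hE; apply/tangentE => //.
      by rewrite pT -row_mul mulmxA TT mul1mx.
    by rewrite -mulmxA (mulmxA E) EE mul1mx.
  have sym m (F : 'M[R]_(m, n)) : (F^T *m F)^T = F^T *m F.
    by rewrite trmx_mul trmxK.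
  (* Each symmetric projection absorbs the other, so transposition shows that they are equal. *)
  have hS : E^T *m E *m (T^T *m T) = E^T *m E by rewrite -mulmxA h1.
  have hT : T^T *m T *m (E^T *m E) = T^T *m T by rewrite -mulmxA h2.
  by rewrite -hS -[LHS]trmxK trmx_mul !sym hT.
have bT : orthonormal_basis (tangent M2 x) T.
  split=> // v; split.
    move=> /tangent_is_proj/(_ Mx) <-; rewrite pT mulmxA; exact: submxMl.
  move=> /submxP[D ->]; apply/tangentE => //.
  by rewrite pT -!mulmxA (mulmxA T) TT mul1mx.
apply: get_unique; first by exists (1 + d)%N, T; rewrite val.
by move=> r [k [E [bE ->]]]; exact: val.
Qed.

End Extension.

(** * Geodesics of [M2] and the lifted Laplacian *)

Lemma is_derive_arc (x w : 'rV[R]_n) (t : R) :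
  is_derive (t : R) 1 (arc x w) (arc w (- x) t).
Proof.
have := is_derive_trig 1 x w t; rewrite mul1r !scale1r scaleN1r.
by congr is_derive; apply/funext => s; rewrite /arc mul1r.
Qed.

Lemma arcD (x w : 'rV[R]_n) t s :
  arc x w (t + s) = arc (arc x w t) (arc w (- x) t) s.
Proof. by rewrite /arc cosD sinD; apply/rowP => j; rewrite !mxE; ring. Qed.

(** Restarted at time [t], the arc is again an arc in [M2], with this vector as initial velocity. *)
Lemma arc_tangent x w t : (forall t, M2 (arc x w t)) ->
  proj (arc x w t) (arc w (- x) t) = arc w (- x) t.
Proof.
move=> Ma; apply: tangent_is_proj => //; exists (fun s => arc x w (t + s)).
have -> : (fun s => arc x w (t + s)) = arc (arc x w t) (arc w (- x) t).
  by apply/funext => s; rewrite arcD.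
split; last first.
  rewrite derive1E; have h := is_derive_arc (arc x w t) (arc w (- x) t) 0.
  by rewrite (derive_val (is_derive := h)) arc0.
split; first by rewrite arc0.
exists 1; split=> // [k|s _]; last by rewrite -arcD.
apply: (@Ck_subset _ _ _ _ _ setT) => //.
have := Ck_trig k 1 (arc x w t) (arc w (- x) t).
by congr Ck; apply/funext => s; rewrite [in RHS]/arc mul1r.
Qed.

Lemma proj_normal x : M2 x -> proj x x = 0.
Proof.
move=> /M2_lift[th [y [hy ->]]].
rewrite /proj dotC dot_lift_cpx scale0r add0r lift_quad // dot_lift hy scale1r.
by move: (lift_pt th y) => q; apply/rowP => j; rewrite !mxE; field.
Qed.

(* A geodesic satisfies [g'' = - g], normal to [M2], so that the derivative of
   [<tgrad h, g'>] is the Hessian term of the divergence. *)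
Lemma jet_arc f h U x w : open U -> smooth U h ->
  (forall x, U x -> M2 x -> h x = f x) -> U x -> (forall t, M2 (arc x w t)) ->
  jet (fun t => f (arc x w t)) (f x) (dot (tgrad h x) w)
    (dot ('D_w (tgrad h) x) w).
Proof.
move=> oU sh fh Ux Ma; have Mx : M2 x by rewrite -(arc0 x w).
have nU : \forall t \near (0 : R), U (arc x w t).
  have := @arc_continuous _ _ x w 0; rewrite /continuous_at arc0; apply.
  exact: open_nbhs_nbhs.
have nh : \forall t \near (0 : R), h (arc x w t) = f (arc x w t).
  by near=> t; apply: fh => //; near: t.
apply: (near_jet nh); split; first by rewrite arc0 fh.
exists (fun t => dot (tgrad h (arc x w t)) (arc w (- x) t)); split.
- near=> t; have Ut : U (arc x w t) by near: t.
  rewrite -(tgrad_derive sh Ut (Ma t) (arc_tangent t Ma)).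
  exact: is_derive_comp_diff (is_derive_arc x w t) (extension_diff sh Ut).
- by rewrite !arc0.
have dX : differentiable (tgrad h) (arc x w 0).
  by rewrite arc0; exact: tgrad_diff sh _ Ux.
have := is_derive_dot (is_derive_comp_diff (is_derive_arc x w 0) dX)
  (is_derive_arc w (- x) 0).
rewrite !arc0 dotNr [dot (tgrad h x) x]dot_proj // proj_normal // dot0r oppr0 addr0.
exact.
Unshelve. all: by end_near. Qed.

Definition lifted (f : 'rV[R]_n -> R) th y := f (lift_pt th y).

(** The [th]-lines and the great circles of the sphere factor lift to great circle arcs inside [M2]
    whose initial velocities are the rows of [tframe]. *)
Lemma lap_lifted f th y E : smooth_on M2 f -> frame y E ->
  lap (lifted f) th y E (- laplacian M2 f (lift_pt th y)).
Proof.
move=> sf fr; have [hy _ _ _] := fr; set x := lift_pt th y.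
have Mx : M2 x by exact: lift_M2.
have [U [h [oU Ux sh fh]]] := sf x Mx.
have TT := tframe_orthonormal th fr.
rewrite /laplacian opprK (divergenceE oU sh fh Ux Mx TT); last first.
  by move=> w; rewrite tframe_proj.
have E0 t : arc x (x *m J) t = lift_pt (th + t) y by rewrite lift_ptD mulmx_rot.
have Ei v t : arc x (lift_pt th v) t = lift_pt th (arc y v t).
  by rewrite /lift_pt !arc_mulmx.
exists (dot ('D_(x *m J) (tgrad h) x) (x *m J)),
  (fun i => dot ('D_(lift_pt th (row i E)) (tgrad h) x) (lift_pt th (row i E))).
split.
- exists (dot (tgrad h x) (x *m J)).
  have := @jet_arc f h U x (x *m J) oU sh fh Ux.
  rewrite /lifted; under [X in jet X]eq_fun do rewrite E0.
  by apply=> t; rewrite E0; exact: lift_M2.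
- move=> i; exists (dot (tgrad h x) (lift_pt th (row i E))).
  have := @jet_arc f h U x (lift_pt th (row i E)) oU sh fh Ux.
  rewrite /lifted; under [X in jet X]eq_fun do rewrite Ei.
  have [vv yv] := frame_row i fr.
  by apply=> t; rewrite Ei; apply: lift_M2; rewrite dot_arc.
- rewrite big_split_ord big_ord1 row_tframeL; congr (_ + _).
  by apply: eq_bigr => i _; rewrite row_tframeR.
Qed.

Lemma lift_pt_continuous : continuous (fun z : R * 'rV[R]_d.+1 => lift_pt z.1 z.2).
Proof.
have -> : (fun z : R * 'rV[R]_d.+1 => lift_pt z.1 z.2) =
    (fun z : R * 'rV[R]_d.+1 =>
      cos z.1 *: (z.2 *m B) + sin z.1 *: (z.2 *m (B *m J))).
  by apply/funext => z; rewrite /lift_pt mulmx_rot mulmxA.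
have cm (A : 'M[R]_(d.+1, n)) : continuous (fun z : R * 'rV[R]_d.+1 => z.2 *m A).
  apply: (continuous_fun_comp (g := fun y => y *m A)); first exact: continuous_snd.
  exact: mulmxr_continuous.
move=> z; apply: cvgD; apply: cvgZ; try exact: cm.
  exact: (continuous_fun_comp (@continuous_fst _ _) (@continuous_cos R)).
exact: (continuous_fun_comp (@continuous_fst _ _) (@continuous_sin R)).
Qed.

(** Only the values of [f] on [M2] are controlled, hence continuity within the cylinder; near each
    point [f] is replaced by its extension [h]. *)
Lemma lifted_continuous f : smooth_on M2 f ->
  {within cylinder, continuous (fun z : R * 'rV[R]_d.+1 => lifted f z.1 z.2)}.
Proof.
move=> sf; apply/subspace_continuousP => z hz.
have Mz : M2 (lift_pt z.1 z.2) by exact: lift_M2.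
have [U [h [oU Uz sh fh]]] := sf _ Mz.
have ch : {for lift_pt z.1 z.2, continuous h} by exact: sh 0%N _ Uz.
have cz := @lift_pt_continuous z.
have nU : \forall z' \near z, U (lift_pt z'.1 z'.2).
  by apply: cz; exact: open_nbhs_nbhs.
rewrite /from_subspace /lifted -(fh _ Uz Mz).
pose H (z' : R * 'rV[R]_d.+1) := h (lift_pt z'.1 z'.2).
have cH : H @ within cylinder (nbhs z) --> H z.
  apply: cvg_trans (continuous_comp cz ch); apply: cvg_app; exact: cvg_within.
apply: cvg_trans cH; apply: near_eq_cvg; rewrite near_withinE.
near=> z' => hz'.
by rewrite /H fh //; [near: z'|exact: lift_M2].
Unshelve. all: by end_near. Qed.

(** * First eigenvalue *)

Lemma eigenvalue_lower_bound mu : 2 <= d%:R :> R -> eigenvalue_of M2 mu ->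
  mu != 0 -> Num.min 4 (d%:R + 1) <= mu.
Proof.
move=> d2 [f [sf [p [Mp fp]] hf]] mu0; rewrite leNgt; apply/negP.
rewrite lt_min => /andP[mu4 mud].
have [th [y [hy pE]]] := M2_lift Mp.
have eF : eigen mu (lifted f).
  split; first exact: lifted_continuous.
  move=> a z E fr; have [hz _ _ _] := fr.
  have := lap_lifted a sf fr; rewrite hf; last exact: lift_M2.
  by rewrite mulNr.
move/eqP: fp; apply; rewrite pE.
apply: (@eigen_antipodal0 _ _ d2 mu (lifted f)) => // a z hz.
by rewrite /lifted lift_pt_pi.
Qed.

Lemma unit_vector : exists y : 'rV[R]_d.+1, dot y y = 1.
Proof.
exists (delta_mx 0 0); rewrite dotE big_ord_recl big1 ?addr0 => [|i _].
  by rewrite !mxE mulr1.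
by rewrite !mxE /= mul0r.
Qed.

Lemma smooth_on_setT (f : 'rV[R]_n -> R) : smooth setT f -> smooth_on M2 f.
Proof. by move=> sf p _; exists setT, f; split=> //; exact: openT. Qed.

(** Every point of [M2] is a lift, and [lap_unique] compares the given value with that of
    [lap_lifted]. *)
Lemma eigenvalue_from_lap mu f : smooth setT f ->
  (exists th y, dot y y = 1 /\ lifted f th y != 0) ->
  (forall th y E, frame y E -> lap (lifted f) th y E (- (mu * lifted f th y))) ->
  eigenvalue_of M2 mu.
Proof.
move=> sf [th [y [hy f0]]] hl; exists f; split; first exact: smooth_on_setT.
  by exists (lift_pt th y); split=> //; exact: lift_M2.
move=> _ /M2_lift[a [z [hz ->]]]; have [E fr] := frame_exists hz.
have := lap_unique (lap_lifted a (smooth_on_setT sf) fr) (hl a z E fr).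
by move=> /eqP; rewrite eqr_opp => /eqP.
Qed.

Lemma eigenvalue4 : eigenvalue_of M2 4.
Proof.
(* This holds off the sphere too, hence the factor [dot y y]; it is constantly [1] along the
   arcs. *)
have E th y : lifted (fun x => dot (x *m P0) x) th y = cos (2 * th + 0) * dot y y.
  by rewrite /lifted dot_lift_P0 addr0.
apply: (@eigenvalue_from_lap _ (fun x => dot (x *m P0) x)).
- exact: smooth_quadratic.
- by have [y hy] := unit_vector; exists 0, y; rewrite E hy mulr0 addr0 cos0 mulr1.
move=> th y F fr; have -> : lifted (fun x => dot (x *m P0) x) =
    (fun th y => cos (2 * th + 0) * dot y y) by apply/funext => a; apply/funext.
have [hy _ _ _] := fr.
have := @lap_cos_mul R d 2 0 (fun y => dot y y) th y F (fun=> 0).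
rewrite big1 // sub0r hy => H.
have -> : - (4 * (cos (2 * th + 0) * 1)) = cos (2 * th + 0) * - (2 ^+ 2 * 1) :> R.
  by ring.
apply: H => i; exists 0.
have [vv yv] := frame_row i fr.
have -> : (fun t => dot (arc y (row i F) t) (arc y (row i F) t)) = (fun=> 1).
  by apply/funext => t; rewrite dot_arc.
exact: jet_cst.
Qed.

Lemma eigenvalue_dim : eigenvalue_of M2 (d%:R + 1).
Proof.
(* Since [e] lies in the eigenspace, [basis_cpx] removes the sine term. *)
have [y0 hy0] := unit_vector; pose e := lift_pt 0 y0.
have E th y : lifted (fun x => dot e x) th y = cos (1 * th + 0) * dot y y0.
  rewrite /lifted /e /lift_pt rot0 mulmx1 mulmx_rot dotDr !dotZr.
  rewrite mul1r addr0 dot_mulmx -mulmxA BB mulmx1 (dotC y0).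
  by rewrite dot_mulmx -!mulmxA (mulmxA B) basis_cpx mulmx0 dot0r mulr0 addr0.
apply: (@eigenvalue_from_lap _ (fun x => dot e x)).
- exact: smooth_linear.
- by exists 0, y0; rewrite E hy0 mulr0 addr0 cos0 mulr1.
move=> th y F fr; have -> : lifted (fun x => dot e x) =
    (fun th y => cos (1 * th + 0) * dot y y0) by apply/funext => a; apply/funext.
have := @lap_cos_mul R d 1 0 (fun y => dot y y0) th y F (fun=> - dot y y0).
rewrite sumr_const card_ord -(mulr_natr (- dot y y0)) => H.
have -> : - ((d%:R + 1) * (cos (1 * th + 0) * dot y y0)) =
    cos (1 * th + 0) * (- dot y y0 * d%:R - 1 ^+ 2 * dot y y0) :> R by ring.
by apply: H => i; eexists; exact: jet_dot_arc.
Qed.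

Lemma first_eigenvalue_M2 : 2 <= d%:R :> R ->
  first_eigenvalue M2 = Num.min 4 (d%:R + 1).
Proof.
move=> d2; have m0 : 0 < Num.min 4 (d%:R + 1) :> R by rewrite lt_min; lra.
have em : eigenvalue_of M2 (Num.min 4 (d%:R + 1)).
  by rewrite minEle; case: ifP => _; [exact: eigenvalue4|exact: eigenvalue_dim].
apply: xget_unique.
  by split=> // mu; exact: eigenvalue_lower_bound.
move=> lam [l0 el hl]; apply/eqP; rewrite eq_le; apply/andP; split.
  by apply: hl => //; exact: lt0r_neq0.
by apply: eigenvalue_lower_bound => //; exact: lt0r_neq0.
Qed.

End Lift.

End Clifford.

Theorem proposition1p1 (R : realType) (k : nat) (hk : (1 <= k)%N)
    (P : 'I_2 -> 'M[R]_(2 * k + 4)) (hP : symmetric_clifford_system P) :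
  first_eigenvalue (focal_M2 P) = Num.min 4 (2 + k%:R).
Proof.
have [trP PP] := hP.
have sq i : P i *m P i = 1%:M.
  have := PP i i; rewrite eqxx mulr1 -mulr2n -scaler_nat -[RHS]scalemx1.
  by move/scalerI; apply; rewrite pnatr_eq0.
have anti : P 0 *m P 1 = - (P 1 *m P 0).
  by apply/eqP; rewrite -addr_eq0 PP mulr0; apply/eqP/matrixP => i j; rewrite !mxE mul0rn.
(* From here [d = k.+1]: the eigenspace of [P 0] has dimension [k + 2], and [2 <= d] amounts to
   [1 <= k]. *)
have hn : (2 * k + 4 = 2 * k.+2)%N by rewrite !mulnS addnA addnC.
have [B [BB hB]] := clifford_basis (trP 0) (sq 0) (sq 1) anti hn.
have -> : focal_M2 P = M2 (P 0) (P 1).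
  have F x : dot x x = 1 -> OT_FKM_poly P x =
      1 - 2 * (dot (x *m P 0) x ^+ 2 + dot (x *m P 1) x ^+ 2).
    move=> hx; rewrite /OT_FKM_poly hx expr1n big_ord_recl big_ord1.
    by rewrite (_ : lift ord0 ord0 = 1) //; exact/val_inj.
  apply/seteqP; split=> x [hx h]; split=> //; move: h; rewrite /= F //; lra.
rewrite (first_eigenvalue_M2 (trP 0) (trP 1) (sq 0) (sq 1) anti BB hB).
  by congr Num.min; rewrite -natr1; ring.
by rewrite ler_nat.
Qed.
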